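(* Let $p\geq 2$ be an integer. For every integer $k$ coprime with $p$, the Watatani index of $\chi_k(\mathcal{Q}_p^{\mathbb{T}})$ in $\mathcal{Q}_p^{\mathbb{T}}$ is $|k|$.
   Context: For an integer $p\ge 2$, the $p$-adic ring $C^*$-algebra $\mathcal{Q}_p$ is the universal $C^*$-algebra generated by a unitary $U$ and an isometry $S_p$ such that $S_pU=U^pS_p$ and $\sum_{l=0}^{p-1}U^lS_pS_p^*U^{-l}=1$. The gauge automorphisms $\{\alpha_z:z\in\mathbb{T}\}$ are defined by $\alpha_z(S_p)=zS_p$, $\alpha_z(U)=U$, and $\mathcal{Q}_p^{\mathbb{T}}:=\{x\in\mathcal{Q}_p:\alpha_z(x)=x\text{ for all }z\in\mathbb{T}\}$ (it is isomorphic with the Bunce-Deddens algebra of type $p^\infty$). For an integer $k$ coprime with $p$, $\chi_k:\mathcal{Q}_p\to\mathcal{Q}_p$ is the unital $*$-endomorphism with $\chi_k(U)=U^k$, $\chi_k(S_p)=S_p$; it leaves $\mathcal{Q}_p^{\mathbb{T}}$ invariant. Watatani index. Let $\mathcal{A}\subset\mathcal{B}$ be an inclusion of unital $C^*$-algebras with common unit and $E:\mathcal{B}\to\mathcal{A}$ a faithful conditional expectation. A finite family $\{u_1,\dots,u_n\}\subset\mathcal{B}$ is a quasi-basis for $E$ if $x=\sum_{i=1}^n u_iE(u_i^*x)=\sum_{i=1}^nE(xu_i)u_i^*$ for all $x\in\mathcal{B}$. $E$ has finite index if it admits a quasi-basis, and then $\mathrm{Ind}(E):=\sum_{i=1}^nu_iu_i^*$,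 which does not depend on the quasi-basis and lies in the center of $\mathcal{B}$; if $\mathcal{B}$ has trivial center it is a real number $\ge 1$. The Watatani index of $\mathcal{A}$ in $\mathcal{B}$ is the infimum of $\mathrm{Ind}(E)$ over all conditional expectations $E:\mathcal{B}\to\mathcal{A}$ of finite index. *)

(* Defs.v *)
From HB Require Import structures.
From mathcomp Require Import all_boot all_order all_algebra.
From mathcomp Require Import complex.
From mathcomp Require Import all_classical all_reals.

Set Implicit Arguments.
Unset Strict Implicit.
Unset Printing Implicit Defensive.

Import Order.TTheory GRing.Theory Num.Theory.
Import ComplexField.Normc.
Local Open Scope classical_set_scope.
Local Open Scope complex_scope.
Local Open Scope ring_scope.

(* Unital C*-algebras.  [algType] and [normedModType] have no common refinement
   in the library, hence the explicit norm and its completeness.  An [algType]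
   is nontrivial: the zero algebra is not included. *)
HB.mixin Record isCStarAlgebra (R : realType) A of GRing.Algebra R[i] A := {
  star : A -> A;
  starK : involutive star;
  starP : forall (c : R[i]) (x y : A),
    star (c *: x + y) = Num.conj c *: star x + star y;
  starM : forall x y : A, star (x * y) = star y * star x;
  cnorm : A -> R;
  cnorm0_eq0 : forall x : A, cnorm x = 0 -> x = 0;
  cnormZ : forall (c : R[i]) (x : A), cnorm (c *: x) = normc c * cnorm x;
  ler_cnormD : forall x y : A, cnorm (x + y) <= cnorm x + cnorm y;
  ler_cnormM : forall x y : A, cnorm (x * y) <= cnorm x * cnorm y;
  cnorm_cstar : forall x : A, cnorm (star x * x) = cnorm x ^+ 2;
  cnorm_complete : forall x : nat -> A,
    (forall e : R, 0 < e -> exists N : nat, forall m n : nat,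
       (N <= m)%N -> (N <= n)%N -> cnorm (x m - x n) < e) ->
    exists l : A, forall e : R, 0 < e -> exists N : nat, forall n : nat,
      (N <= n)%N -> cnorm (x n - l) < e
}.

#[short(type="cstarAlgType")]
HB.structure Definition CStarAlgebra (R : realType) :=
  {A of GRing.Algebra R[i] A & isCStarAlgebra R A}.

Record starHom (R : realType) (A B : cstarAlgType R) := StarHom {
  starhom_fun :> {lrmorphism A -> B};
  starhomP : forall x : A, starhom_fun (star x) = star (starhom_fun x)
}.

(* Integer powers of [u], the inverse of [u] being [star u]; meaningful only
   when [u] is unitary. *)
Definition upow (R : realType) (A : cstarAlgType R) (u : A) (k : int) : A :=
  match k with
  | Posz n => u ^+ n
  | Negz n => star u ^+ n.+1
  end.

Definition padic_rel (R : realType) (p : nat) (A : cstarAlgType R) (u s : A) :=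
  [/\ star u * u = 1, u * star u = 1, star s * s = 1,
      s * u = u ^+ p * s &
      \sum_(l < p) u ^+ l * s * star s * upow u (- l%:Z) = 1].

(* The universal C*-algebra on the relations [padic_rel p]. *)
Record padicRingAlg (R : realType) (p : nat) := PadicRingAlg {
  padic_alg :> cstarAlgType R;
  padic_U : padic_alg;
  padic_S : padic_alg;
  padic_relP : padic_rel p padic_U padic_S;
  padic_univ : forall (B : cstarAlgType R) (u s : B), padic_rel p u s ->
    exists f : starHom padic_alg B,
      [/\ f padic_U = u, f padic_S = s &
          forall g : starHom padic_alg B,
            g padic_U = u -> g padic_S = s -> g =1 f]
}.

Definition padic_lift (R : realType) (p : nat) (Q : padicRingAlg R p)
    (B : cstarAlgType R) (u s : B) (h : padic_rel p u s) : starHom Q B :=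
  projT1 (cid (padic_univ Q h)).

Lemma padic_liftP (R : realType) (p : nat) (Q : padicRingAlg R p)
    (B : cstarAlgType R) (u s : B) (h : padic_rel p u s) :
  padic_lift Q h (padic_U Q) = u /\ padic_lift Q h (padic_S Q) = s.
Proof. by rewrite /padic_lift; case: cid => f /= []. Qed.

Section StarTheory.
Variables (R : realType) (A : cstarAlgType R).
Implicit Types (x u s : A) (c : R[i]).

Lemma star0 : star (0 : A) = 0.
Proof.
have := starP (1 : R[i]) (0 : A) 0.
rewrite scaler0 addr0 conjC1 scale1r => /eqP.
by rewrite -[X in X == _]addr0 (inj_eq (addrI _)) eq_sym => /eqP.
Qed.

Lemma starZ c x : star (c *: x) = Num.conj c *: star x.
Proof. by rewrite -[c *: x]addr0 starP star0 addr0. Qed.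

Lemma star1 : star (1 : A) = 1.
Proof. by rewrite -[LHS]mulr1 -{2}[1]starK -starM mulr1 starK. Qed.

Lemma starX x n : star (x ^+ n) = star x ^+ n.
Proof. by elim: n => [|n IH]; rewrite ?expr0 ?star1// exprS starM IH exprSr. Qed.

Section Unitary.
Variable u : A.
Hypotheses (u1 : star u * u = 1) (u2 : u * star u = 1).

Lemma upow_oppz n : upow u (- n%:Z) = star u ^+ n.
Proof. by case: n => [|n]; rewrite ?oppr0//= -NegzE. Qed.

Lemma upowS k : upow u (1 + k) = u * upow u k.
Proof.
case: k => n; first by rewrite -PoszD add1n /= exprS.
rewrite NegzE (_ : 1 - n.+1%:Z = - n%:Z); last first.
  by rewrite -addn1 PoszD opprD addrCA subrr addr0.
by rewrite !upow_oppz exprS mulrA u2 mul1r.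
Qed.

Lemma upow_add k m : upow u (k + m) = upow u k * upow u m.
Proof.
case: k => n.
  elim: n => [|n IH]; first by rewrite add0r /= mul1r.
  by rewrite -add1n PoszD -addrA upowS IH upowS mulrA.
have uP j : upow u (-1 + j) = star u * upow u j.
  have e : 1 + (-1 + j) = j by rewrite addrA subrr add0r.
  by rewrite -{2}e upowS mulrA u1 mul1r.
elim: n => [|n IH]; first by rewrite NegzE uP /= expr1.
have e : Negz n.+1 = -1 + Negz n by rewrite !NegzE -add1n PoszD opprD.
by rewrite e -addrA (uP (Negz n + m)) IH (uP (Negz n)) mulrA.
Qed.

Lemma upowN k : upow u (- k) = star (upow u k).
Proof.
case: k => n; first by rewrite upow_oppz /= starX.
by rewrite NegzE opprK /= starX starK.
Qed.

Lemma upowMn k n : upow u (k * n%:Z) = upow u k ^+ n.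
Proof.
elim: n => [|n IH]; first by rewrite mulr0.
by rewrite -add1n PoszD mulrDr mulr1 upow_add IH exprS.
Qed.

Lemma upowK k : upow u k * star (upow u k) = 1.
Proof. by rewrite -upowN -upow_add subrr. Qed.

Lemma upowVK k : star (upow u k) * upow u k = 1.
Proof. by rewrite -upowN -upow_add addNr. Qed.

Variables (p : nat) (s : A).
Hypotheses (su : s * u = u ^+ p * s).

Lemma upow_comm k : s * upow u k = upow u k ^+ p * s.
Proof.
have H n : s * u ^+ n = (u ^+ n) ^+ p * s.
  elim: n => [|n IH]; first by rewrite expr0 expr1n mulr1 mul1r.
  rewrite exprSr mulrA IH -mulrA su mulrA exprMn_comm//.
  exact/commr_sym/commrX.
case: k => n; first exact: H.
have e : upow u (Negz n) = star (u ^+ n.+1) by rewrite /= starX.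
have e1 : u ^+ n.+1 * star (u ^+ n.+1) = 1 := upowK n.+1.
have e2 : star (u ^+ n.+1) * u ^+ n.+1 = 1 := upowVK n.+1.
rewrite e; move: (u ^+ n.+1) (H n.+1) e1 e2 => v Hv e1 e2.
have ep : star v ^+ p * v ^+ p = 1.
  elim: (p) => [|m IH]; first by rewrite !expr0 mulr1.
  by rewrite exprSr exprS mulrA -[X in X * _]mulrA e2 mulr1.
by rewrite -[LHS]mul1r -ep -!mulrA [v ^+ p * _]mulrA -Hv -!mulrA e1 mulr1.
Qed.

End Unitary.

Lemma padic_rel_gauge (p : nat) u s (z : R[i]) :
  `|z| = 1 -> padic_rel p u s -> padic_rel p u (z *: s).
Proof.
move=> z1 [u1 u2 s1 su hs].
have zz : Num.conj z * z = 1 by rewrite mulrC -normCK z1 expr1n.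
split=> //.
- by rewrite starZ -scalerAl -scalerAr scalerA zz scale1r.
- by rewrite -scalerAl su scalerAr.
- rewrite -[RHS]hs; apply: eq_bigr => l _; congr (_ * _).
  by rewrite starZ -!scalerAr -!scalerAl scalerA zz scale1r.
Qed.

Lemma padic_rel_chi (p : nat) u s (k : int) :
  coprimez k p -> padic_rel p u s -> padic_rel p (upow u k) s.
Proof.
move=> kp [u1 u2 s1 su hs].
case: p kp su hs => [|p] kp su hs.
  by move: hs; rewrite big_ord0 => /esym/eqP; rewrite oner_eq0.
split=> //; [exact: upowVK|exact: upowK|exact: upow_comm|].
pose F (n : int) := upow u n * s * star s * upow u (- n).
have Fp (n : int) : F (n + p.+1%:Z) = F n.
  have e1 : upow u (n + p.+1%:Z) = upow u n * u ^+ p.+1 by rewrite upow_add.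
  have e2 : upow u (- (n + p.+1%:Z)) = star (u ^+ p.+1) * upow u (- n).
    by rewrite addrC opprD upow_add// (upowN _ p.+1%:Z).
  have e3 : star s * (star (u ^+ p.+1) * upow u (- n)) =
            star u * (star s * upow u (- n)).
    by rewrite !mulrA -!starM su.
  rewrite /F e1 e2 -!mulrA e3 [u ^+ p.+1 * _]mulrA -su -!mulrA.
  by rewrite [u * (star u * _)]mulrA u2 mul1r.
have Fpn (n : int) (m : nat) : F (n + m%:Z * p.+1%:Z) = F n.
  elim: m => [|m IH]; first by rewrite mul0r addr0.
  by rewrite -addn1 PoszD mulrDl mul1r addrA Fp.
have Fmod (n : int) : F n = F (n %% p.+1)%Z.
  rewrite {1}(divz_eq n p.+1) addrC; case: (n %/ p.+1)%Z => m; first exact: Fpn.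
  by rewrite NegzE mulNr -[LHS](Fpn _ m.+1) subrK.
pose f (l : 'I_p.+1) : 'I_p.+1 := inord `|((k * l%:Z) %% p.+1)%Z|.
have fE l : (f l)%:Z = ((k * l%:Z) %% p.+1)%Z.
  have h0 : (0 <= (k * l%:Z) %% p.+1)%Z by rewrite modz_ge0.
  rewrite /f inordK ?gez0_abs//.
  by rewrite -ltz_nat gez0_abs// ltz_pmod.
have f_inj : injective f.
  move=> l m /(congr1 (fun i : 'I_p.+1 => (nat_of_ord i)%:Z)); rewrite !fE => /eqP.
  rewrite eqz_mod_dvd -mulrBr Gauss_dvdzr; last by rewrite coprimez_sym.
  rewrite -eqz_mod_dvd !modz_small ?ltz_nat ?ltn_ord//.
  by move=> /eqP[] /val_inj.
rewrite -[RHS]hs.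
transitivity (\sum_(l < p.+1) F l%:Z) => //.
rewrite [RHS](reindex_inj f_inj); apply: eq_bigr => l _.
rewrite fE -Fmod /F upowMn// (upowN _ (k * l%:Z)) upowMn//.
by rewrite upow_oppz starX.
Qed.

End StarTheory.

Section Endomorphisms.
Variables (R : realType) (p : nat) (Q : padicRingAlg R p).

Definition gauge (z : R[i]) (z1 : `|z| = 1) : starHom Q Q :=
  padic_lift Q (padic_rel_gauge z1 (padic_relP Q)).

Definition gauge_fixed : set Q :=
  [set x | forall (z : R[i]) (z1 : `|z| = 1), gauge z1 x = x].

Definition chi (k : int) (kp : coprimez k p) : starHom Q Q :=
  padic_lift Q (padic_rel_chi kp (padic_relP Q)).

Lemma gaugeP (z : R[i]) (z1 : `|z| = 1) :
  gauge z1 (padic_U Q) = padic_U Q /\ gauge z1 (padic_S Q) = z *: padic_S Q.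
Proof. exact: padic_liftP. Qed.

Lemma chiP (k : int) (kp : coprimez k p) :
  chi kp (padic_U Q) = upow (padic_U Q) k /\ chi kp (padic_S Q) = padic_S Q.
Proof. exact: padic_liftP. Qed.

End Endomorphisms.

Arguments gauge {R p} Q {z} z1.
Arguments gauge_fixed {R p} Q.
Arguments chi {R p} Q {k} kp.

(* An inclusion of unital C*-algebras is given by two unital C*-subalgebras
   A `<=` B of an ambient C*-algebra M; a map B -> A is given by E : M -> M,
   whose values outside B are irrelevant. *)
Section Watatani.
Variables (R : realType) (M : cstarAlgType R).
Implicit Types (A B : set M) (E : M -> M).

Record conditional_expectation A B E : Prop := ConditionalExpectation {
  ce_range : forall x, B x -> A (E x);
  ce_linear : forall (c : R[i]) x y, B x -> B y ->
    E (c *: x + y) = c *: E x + E y;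
  ce_id : forall a, A a -> E a = a;
  ce_bimodule : forall a x b, A a -> B x -> A b ->
    E (a * x * b) = a * E x * b;
  ce_positive : forall x, B x -> exists2 y, A y & E (star x * x) = star y * y
}.

Definition faithful B E := forall x, B x -> E (star x * x) = 0 -> x = 0.

Definition quasi_basis B E n (u : 'I_n -> M) :=
  (forall i, B (u i)) /\
  forall x, B x -> x = \sum_(i < n) u i * E (star (u i) * x) /\
                   x = \sum_(i < n) E (x * u i) * star (u i).

(* The elements Ind(E), for E ranging over the faithful conditional
   expectations of finite index. *)
Definition index_values A B : set M :=
  [set b | exists E, [/\ conditional_expectation A B E, faithful B E &
     exists n (u : 'I_n -> M),
       quasi_basis B E u /\ b = \sum_(i < n) u i * star (u i)]].

(* Every Ind(E) is a real scalar, and [w] is the infimum of these scalars;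
   [has_inf] is needed because [inf] is 0 by convention on sets that are empty
   or unbounded below. *)
Definition is_watatani_index A B (w : R) :=
  exists V : set R,
    [/\ index_values A B = (fun r : R => r%:C%:A) @` V, has_inf V & inf V = w].

End Watatani.

(* Main.v *)
From HB Require Import structures.
Require Import Defs.
From mathcomp Require Import all_boot all_order all_algebra.
From mathcomp Require Import complex ring lra zify.
From mathcomp Require Import all_classical all_reals.
From mathcomp Require Import topology normedtype trigo.
Import Order.TTheory GRing.Theory Num.Theory.
Import ComplexField.Normc numFieldNormedType.Exports.
Local Open Scope classical_set_scope.
Local Open Scope complex_scope.
Local Open Scope ring_scope.

(** The gauge-invariant part B of Q_p is the closed span of the products f U^m,
    where f runs through the projections U^i S^n S*^n U^-i. These projections
    behave like the indicators of the cosets i + p^n Z_p, which U translates by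
    1: B is the crossed product of the continuous functions on Z_p by
    translation. As k is coprime with p, multiplication by k permutes the cosets
    of p^n Z_p, which is how chi_k acts on these projections; so the image A of B
    is spanned by the products f U^(k m). Thus A should have the
    unitaries U^j, 0 <= j < |k|, as a basis of B, and index |k|.

    The expectation of B onto A which keeps the powers of U divisible by k is the
    average of the dual automorphisms U |-> z U over the k-th roots of unity z
    ([expectation]). These need not come from automorphisms of Q_p. But when z is a
    p^n-th root of unity, the dual automorphism is inner, implemented by
    [dual_unitary]; and p-power roots of unity are dense in the circle, so that
    every dual automorphism is a pointwise limit of inner ones ([dual]). Fourier
    inversion on Z/k shows that the U^j form a quasi-basis
    ([expectation_quasi_basis]), of index |k|.

    No other expectation has to be considered. The elements of B that commute
    with A are scalars ([relative_commutant_scalar]): conjugating by the unitaries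
    [dual_unitary] and by the powers of U^k, all of which are in A, and taking
    averages, one turns an approximation by a combination of products f U^m into
    a scalar. If E is any expectation onto A, then E(U^j) U^-j commutes with A,
    so it is a scalar, which must be 0 when k does not divide j
    ([expectation_upow_eq0]). Hence the U^j form a quasi-basis for E as well, and
    the index of E is |k| ([index_value]). The set of index values is therefore
    the singleton of |k|.

    Two facts about general C*-algebras are needed and proved here by elementary
    means, without spectral theory. Elements x* x, and their sums, are squares of
    self-adjoint elements ([pos_star_mul], [posD]); this gives the positivity and
    faithfulness of averages and the contractivity of homomorphisms, and even the
    orthogonality of the projections above comes from it. The range of a
    homomorphism is closed ([range_closed]) and contains square roots of its
    positive elements ([range_pos_root]); this is how the averages and the roots
    are seen to be in A. *)

Set Implicit Arguments.
Unset Strict Implicit.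
Unset Printing Implicit Defensive.

(** * Null sequences of reals *)

Section Null.
Variable R : realType.
Implicit Types r s : nat -> R.

(** One-sided, without absolute values: it is only used for sequences of norms,
    or for sequences dominating them. *)
Definition null r := forall e, 0 < e -> exists N, forall n, (N <= n)%N -> r n < e.

Lemma null_le r s : (forall n, r n <= s n) -> null s -> null r.
Proof.
move=> h hs e /hs[N hN]; exists N => n /hN; exact: le_lt_trans.
Qed.

Lemma nullD r s : null r -> null s -> null (fun n => r n + s n).
Proof.
move=> hr hs e e0; have e2 : 0 < e / 2 by rewrite divr_gt0.
have [N1 h1] := hr _ e2; have [N2 h2] := hs _ e2.
exists (maxn N1 N2) => n; rewrite geq_max => /andP[/h1 a /h2 b]; lra.
Qed.

Lemma nullZ c r : 0 <= c -> null r -> null (fun n => c * r n).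
Proof.
move=> c0 hr e e0; have c1 : 0 < c + 1 by lra.
have [N h] := hr _ (divr_gt0 e0 c1).
exists N => n /h; rewrite ltr_pdivlMr// mulrC.
case: (ltP (r n) 0) => [rn _|rn]; last lra.
by apply: (le_lt_trans _ e0); rewrite mulr_ge0_le0// ltW.
Qed.

Lemma nullM r s : (forall n, 0 <= r n) -> (forall n, 0 <= s n) ->
  null r -> null s -> null (fun n => r n * s n).
Proof.
move=> r0 s0 hr hs e e0.
have [N1 h1] := hr _ ltr01; have [N2 h2] := hs _ e0.
exists (maxn N1 N2) => n; rewrite geq_max => /andP[/h1 a /h2 b].
by apply: le_lt_trans b; rewrite ler_piMl// ltW.
Qed.

Lemma null0 : null (fun=> 0).
Proof. by move=> e e0; exists 0%N. Qed.

Lemma null_shift r : null r -> null (fun n => r n.+1).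
Proof. by move=> hr e /hr[N h]; exists N => n /leqW/h. Qed.

Lemma nondecreasing_bounded_cauchy r (M : R) :
  (forall n, r n <= r n.+1) -> (forall n, r n <= M) ->
  forall e, 0 < e -> exists N, forall n, (N <= n)%N -> r n - r N < e.
Proof.
move=> mono bd e e0.
have hs : has_sup (range r).
  by split; [exists (r 0%N), 0%N | exists M => _ [n _ <-]].
have [_ [N _ <-] hN] := sup_adherent e0 hs.
exists N => n _.
have : r n <= sup (range r) by apply: (sup_upper_bound hs); exists n.
lra.
Qed.

End Null.

(** * Norm and limits in a C*-algebra *)

Section Norm.
Variables (R : realType) (A : cstarAlgType R).
Implicit Types (x y z h v : A) (c : R[i]) (r : R).

Lemma cnorm0 : cnorm (0 : A) = 0.
Proof. by rewrite -(scale0r (0 : A)) cnormZ normc0 mul0r. Qed.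

Lemma cnormN x : cnorm (- x) = cnorm x.
Proof. by rewrite -scaleN1r cnormZ normcN normc1 mul1r. Qed.

Lemma cnormBC x y : cnorm (x - y) = cnorm (y - x).
Proof. by rewrite -cnormN opprB. Qed.

Lemma ler_cnormB x y : cnorm (x - y) <= cnorm x + cnorm y.
Proof. by rewrite -(cnormN y) ler_cnormD. Qed.

Lemma cnorm_ge0 x : 0 <= cnorm x.
Proof. have := ler_cnormB x x; rewrite subrr cnorm0; lra. Qed.

Lemma cnorm_dist x y z : cnorm (x - z) <= cnorm (x - y) + cnorm (y - z).
Proof. by rewrite -[x - z](subrKA y) ler_cnormD. Qed.

Lemma cnorm_eq0 x : cnorm x <= 0 -> x = 0.
Proof. by move=> h; apply: cnorm0_eq0; apply: le_anti; rewrite h cnorm_ge0. Qed.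

Lemma ler_cnorm_sum (I : Type) (s : seq I) (F : I -> A) :
  cnorm (\sum_(i <- s) F i) <= \sum_(i <- s) cnorm (F i).
Proof.
elim: s => [|i s IH]; first by rewrite !big_nil cnorm0.
by rewrite !big_cons (le_trans (ler_cnormD _ _))// lerD2l.
Qed.

Lemma normcR r : normc (r%:C : R[i]) = `|r|.
Proof. by rewrite /normc /= expr0n addr0 sqrtr_sqr. Qed.

Lemma cnormZr r x : cnorm (r%:C *: x) = `|r| * cnorm x.
Proof. by rewrite cnormZ normcR. Qed.

Lemma starZr r x : star (r%:C *: x) = r%:C *: star x.
Proof. by rewrite starZ; congr (_ *: _); apply: conjc_real. Qed.

Lemma starD x y : star (x + y) = star x + star y.
Proof. by have := starP (1 : R[i]) x y; rewrite conjC1 !scale1r. Qed.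

Lemma starN x : star (- x) = - star x.
Proof. by rewrite -scaleN1r starZ rmorphN rmorph1 scaleN1r. Qed.

Lemma starB x y : star (x - y) = star x - star y.
Proof. by rewrite starD starN. Qed.

Lemma star_sum (I : Type) (s : seq I) (F : I -> A) :
  star (\sum_(i <- s) F i) = \sum_(i <- s) star (F i).
Proof.
elim: s => [|i s IH]; first by rewrite !big_nil star0.
by rewrite !big_cons starD IH.
Qed.

Lemma cnorm_star x : cnorm (star x) = cnorm x.
Proof.
suff h y : cnorm y <= cnorm (star y).
  by apply: le_anti; rewrite h -{2}(starK x) h.
have [->|/eqP y0] := pselect (y = 0); first by rewrite star0.
have ny : 0 < cnorm y.
  rewrite lt_neqAle cnorm_ge0 andbT eq_sym; apply: contra y0 => /eqP.
  by move/cnorm0_eq0 ->.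
by have := ler_cnormM (star y) y; rewrite cnorm_cstar expr2 ler_pM2r.
Qed.

Lemma cnorm1 : cnorm (1 : A) = 1.
Proof.
have n1 : cnorm (1 : A) != 0.
  by apply/eqP => /cnorm0_eq0 /eqP; rewrite oner_eq0.
apply: (mulfI n1); rewrite mulr1 -expr2 -cnorm_cstar star1 mulr1.
by [].
Qed.

Lemma cnorm_sa h : star h = h -> cnorm (h * h) = cnorm h ^+ 2.
Proof. by move=> hs; rewrite -{1}hs cnorm_cstar. Qed.

Lemma cnorm_isometry v : star v * v = 1 -> cnorm v = 1.
Proof.
move=> v1; have := cnorm_cstar v; rewrite v1 cnorm1 => /esym/eqP.
by rewrite sqrp_eq1 ?cnorm_ge0// => /eqP.
Qed.

Lemma cnorm_conj v x : star v * v = 1 -> cnorm (v * x * star v) <= cnorm x.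
Proof.
move=> v1; have nv := cnorm_isometry v1.
have := ler_cnormM (v * x) (star v); have := ler_cnormM v x.
by rewrite cnorm_star nv mulr1 mul1r => a b; exact: le_trans b a.
Qed.

Lemma sa_nilp h : star h = h -> h * h = 0 -> h = 0.
Proof.
move=> hs h0; apply: cnorm0_eq0.
by have := cnorm_sa hs; rewrite h0 cnorm0 => /esym/eqP; rewrite sqrf_eq0 => /eqP.
Qed.

End Norm.

Section Limits.
Variables (R : realType) (A : cstarAlgType R).
Implicit Types (x y : nat -> A) (a b l z : A) (c : R[i]) (X : set A).

Definition cto x l := null (fun n => cnorm (x n - l)).

Lemma cto_unique x a b : cto x a -> cto x b -> a = b.
Proof.
move=> ha hb; apply/eqP; rewrite -subr_eq0; apply/eqP/cnorm_eq0.
rewrite leNgt; apply/negP => e0.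
have h : null (fun n => cnorm (x n - a) + cnorm (x n - b)) by exact: nullD.
have [N /(_ N (leqnn N))] := h _ e0.
rewrite (cnormBC (x N) a); have := cnorm_dist a (x N) b; lra.
Qed.

Lemma cto_cst a : cto (fun=> a) a.
Proof. by rewrite /cto subrr cnorm0; exact: null0. Qed.

Lemma ctoD x y a b : cto x a -> cto y b -> cto (fun n => x n + y n) (a + b).
Proof.
move=> hx hy; apply: null_le (nullD hx hy) => n /=.
by rewrite opprD addrACA ler_cnormD.
Qed.

Lemma ctoZ c x a : cto x a -> cto (fun n => c *: x n) (c *: a).
Proof.
move=> hx; have c0 : 0 <= normc c by case: c => u v; rewrite /normc sqrtr_ge0.
apply: null_le (nullZ c0 hx) => n /=.
by rewrite -scalerBr cnormZ.
Qed.

Lemma ctoM x y a b : cto x a -> cto y b -> cto (fun n => x n * y n) (a * b).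
Proof.
move=> hx hy.
apply: null_le (nullD (nullM (fun n => cnorm_ge0 (x n - a))
  (fun n => cnorm_ge0 (y n - b)) hx hy)
  (nullD (nullZ (cnorm_ge0 a) hy) (nullZ (cnorm_ge0 b) hx))) => n /=.
have -> : x n * y n - a * b =
    (x n - a) * (y n - b) + (x n - a) * b + a * (y n - b).
  rewrite -{1}(subrK a (x n)) -{1}(subrK b (y n)) mulrDl !mulrDr addrA addrK.
  by [].
have := ler_cnormD ((x n - a) * (y n - b) + (x n - a) * b) (a * (y n - b)).
have := ler_cnormD ((x n - a) * (y n - b)) ((x n - a) * b).
have := ler_cnormM (x n - a) (y n - b).
have := ler_cnormM a (y n - b).
have := ler_cnormM (x n - a) b.
lra.
Qed.

Lemma cto_star x a : cto x a -> cto (fun n => star (x n)) (star a).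
Proof. by move=> hx; apply: null_le hx => n /=; rewrite -starB cnorm_star. Qed.

Lemma cto_shift x a : cto x a -> cto (fun n => x n.+1) a.
Proof. exact: null_shift. Qed.

Lemma cto_norm_le x a (C : R) : (forall n, cnorm (x n) <= C) -> cto x a ->
  cnorm a <= C.
Proof.
move=> hx ha; rewrite leNgt; apply/negP; rewrite -subr_gt0 => /ha[N].
move=> /(_ N (leqnn N)); rewrite cnormBC.
have := hx N; have := ler_cnormD (a - x N) (x N); rewrite subrK; lra.
Qed.

Lemma cauchy_cto x : (forall e : R, 0 < e -> exists N : nat, forall n : nat,
    (N <= n)%N -> cnorm (x n - x N) < e) -> exists l, cto x l.
Proof.
move=> hx; apply: cnorm_complete => e e0.
have e2 : 0 < e / 2 by rewrite divr_gt0.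
have [N hN] := hx _ e2; exists N => m n /hN h1 /hN h2.
have := cnorm_dist (x m) (x N) (x n); rewrite (cnormBC (x N) (x n)); lra.
Qed.

End Limits.

(** * Positive elements and square roots *)

Section Positive.
Variables (R : realType) (A : cstarAlgType R).
Implicit Types (a b c g h m s x y z v : A) (r t : R).

Lemma commrZ (k : R[i]) x y : GRing.comm x y -> GRing.comm x (k *: y).
Proof. by move=> xy; rewrite /GRing.comm -scalerAr -scalerAl xy. Qed.

Lemma conj_i : Num.conj (Complex 0 1 : R[i]) = - Complex 0 1.
Proof. by apply/eqP; rewrite eq_complex /= oppr0 !eqxx. Qed.

Lemma halfZ x : 2^-1%:C *: (x + x) = x.
Proof.
by rewrite -mulr2n -(scaler_nat 2 x) scalerA -(rmorph_nat (real_complex R)) -rmorphM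
  mulVf ?pnatr_eq0// rmorph1 scale1r.
Qed.

Lemma real_scale_comp r t x : r%:C *: (t%:C *: x) = (r * t)%:C *: x.
Proof. by rewrite scalerA -rmorphM. Qed.

Lemma real_scaleK r x : r != 0 -> r%:C *: (r^-1%:C *: x) = x.
Proof. by move=> r0; rewrite real_scale_comp divff// rmorph1 scale1r. Qed.

Lemma sqrB_comm a b : GRing.comm a b -> a * a - b * b = (a - b) * (a + b).
Proof. by move=> ab; rewrite mulrBl !mulrDr ab opprD addrA addrK. Qed.

Lemma sa_mul a b : star a = a -> star b = b -> GRing.comm a b ->
  star (a * b) = a * b.
Proof. by move=> sa sb ab; rewrite starM sa sb. Qed.

(** A square root of 1 - x without functional calculus: 1 - y is one exactly
    when y = (x + y^2) / 2, and iterating this from 0 converges because the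
    increments are dominated by those of the scalar iteration for x = 1, which
    increases and is bounded by 1. The limit commutes with the commutant of x
    because all the iterates do. *)
Lemma sqrt_one_sub x : star x = x -> cnorm x <= 1 ->
  exists y, [/\ star y = y, cnorm y <= 1, (1 - y) * (1 - y) = 1 - x &
    forall z, GRing.comm z x -> GRing.comm z y].
Proof.
move=> sx nx.
pose y n := iter n (fun y => 2^-1%:C *: (x + y * y)) 0.
(* the scalar iteration that dominates y *)
pose c n := iter n (fun c : R => 2^-1 * (1 + c * c)) 0.
have yS n : y n.+1 = 2^-1%:C *: (x + y n * y n) by [].
have cS n : c n.+1 = 2^-1 * (1 + c n * c n) by [].
have c01 n : 0 <= c n <= 1.
  elim: n => [|n /andP[c0 c1]]; first by rewrite lexx ler01.
  by rewrite cS; apply/andP; split; nra.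
have cmono n : c n <= c n.+1.
  elim: n => [|n IH]; first by rewrite cS; have := c01 0%N; nra.
  by rewrite cS (cS n.+1); have := c01 n; have := c01 n.+1; nra.
have hh : `|2^-1 : R| = 2^-1 by rewrite ger0_norm// invr_ge0.
have yc n : cnorm (y n) <= c n.
  elim: n => [|n IH]; first by rewrite /= cnorm0.
  rewrite yS cS cnormZr hh ler_pM2l ?invr_gt0//.
  apply: le_trans (ler_cnormD _ _) _; apply: lerD => //.
  apply: le_trans (ler_cnormM _ _) _.
  by apply: ler_pM; rewrite ?cnorm_ge0.
have ycomm z n : GRing.comm z x -> GRing.comm z (y n).
  move=> zx; elim: n => [|n IH]; first exact: commr0.
  by rewrite yS; apply/commrZ/commrD => //; apply: commrM.
have yxc n : GRing.comm (y n) x by apply/commr_sym/ycomm.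
have yd n : cnorm (y n.+1 - y n) <= c n.+1 - c n.
  elim: n => [|n IH].
    by have := yc 1%N; rewrite /c /y /= !subr0.
  have -> : y n.+2 - y n.+1 = 2^-1%:C *: ((y n.+1 - y n) * (y n.+1 + y n)).
    rewrite (yS n.+1) {2}(yS n) -scalerBr; congr (_ *: _).
    by rewrite opprD addrACA subrr add0r sqrB_comm//; apply/ycomm/yxc.
  rewrite cnormZr hh.
  apply: (@le_trans _ _ (2^-1 * ((c n.+1 - c n) * (c n.+1 + c n)))).
    rewrite ler_pM2l ?invr_gt0//; apply: le_trans (ler_cnormM _ _) _.
    apply: ler_pM; rewrite ?cnorm_ge0//.
    by apply: le_trans (ler_cnormD _ _) (lerD _ _).
  move: (cS n.+1) (cS n); move: (c n.+2) (c n.+1) (c n) => c2 c1 c0; lra.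
have ydd n k : cnorm (y (n + k)%N - y n) <= c (n + k)%N - c n.
  elim: k => [|k IH]; first by rewrite addn0 !subrr cnorm0.
  rewrite addnS; have := cnorm_dist (y (n + k).+1) (y (n + k)%N) (y n).
  have := yd (n + k)%N; lra.
have [l hl] : exists l, cto y l.
  apply: cauchy_cto => e e0.
  have c1 n : c n <= 1 by have /andP[] := c01 n.
  have [N hN] := nondecreasing_bounded_cauchy cmono c1 e0.
  exists N => n Nn; rewrite -(subnKC Nn); apply: le_lt_trans (ydd _ _) _.
  by apply: hN; exact: leq_addr.
have sy n : star (y n) = y n.
  elim: n => [|n IH]; first by rewrite /= star0.
  by rewrite yS starZr starD sx starM !IH.
have lE : l = 2^-1%:C *: (x + l * l).
  apply: cto_unique (cto_shift hl) _; apply: ctoZ; apply: ctoD; first exact: cto_cst.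
  exact: ctoM.
exists l; split.
- apply: cto_unique (cto_star hl) _; rewrite (_ : (fun n => _) = y)//.
  by apply/funext => n; rewrite sy.
- apply: cto_norm_le hl => n; apply: le_trans (yc n) _.
  by have /andP[] := c01 n.
- rewrite mulrBl mul1r mulrBr mulr1 opprB addrACA -opprD.
  have -> : x = l + l - l * l.
    apply/eqP; rewrite eq_sym subr_eq; apply/eqP.
    rewrite {1 2}lE -scalerDr -[RHS]halfZ; congr (_ *: _).
  by rewrite opprB addrA.
- move=> z zx; apply: cto_unique (ctoM (cto_cst z) hl) _.
  have := ctoM hl (cto_cst z); congr (cto _ _); apply/funext => n.
  exact/esym/ycomm.
Qed.

(** The norm of h + i g, whose absolute value squared is h^2 + g^2, bounds the
    norm of its real part h. *)
Lemma commuting_sqr_norm h g : star h = h -> star g = g -> GRing.comm h g ->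
  cnorm h ^+ 2 <= cnorm (h * h + g * g).
Proof.
move=> sh sg hg; pose i : R[i] := Complex 0 1.
have ii : i * i = -1 by rewrite -expr2 sqr_i.
have ci : Num.conj i = - i by exact: conj_i.
pose u := h + i *: g.
have su : star u = h - i *: g by rewrite starD starZ sh sg ci scaleNr.
have uu : star u * u = h * h + g * g.
  rewrite su /u mulrBl !mulrDr -!scalerAr -!scalerAl scalerA ii hg.
  by rewrite scaleN1r opprD opprK addrA addrK.
rewrite -uu cnorm_cstar.
apply: (@lerXn2r _ 2); rewrite ?nnegrE ?cnorm_ge0//.
rewrite -(halfZ h).
have -> : h + h = u + star u by rewrite su /u addrACA subrr addr0.
rewrite cnormZr ger0_norm ?invr_ge0//.
have := ler_cnormD u (star u); rewrite cnorm_star; lra.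
Qed.

Lemma commuting_unit_norm h g : star h = h -> star g = g -> GRing.comm h g ->
  h * h + g * g = 1 -> cnorm h <= 1.
Proof.
move=> sh sg hg e; have := commuting_sqr_norm sh sg hg.
by rewrite e cnorm1 expr_le1 ?cnorm_ge0.
Qed.

(** Squares of self-adjoint elements: this form of positivity passes through
    homomorphisms at once and avoids any mention of the spectrum. *)
Definition pos h := exists2 y, star y = y & h = y * y.

Lemma pos_sa h : pos h -> star h = h.
Proof. by case=> y sy ->; rewrite starM sy. Qed.

Lemma pos_sqr y : star y = y -> pos (y * y).
Proof. by exists y. Qed.

Lemma pos0 : pos 0. Proof. by exists 0; rewrite ?star0 ?mul0r. Qed.

Lemma pos1 : pos 1. Proof. by exists 1; rewrite ?star1 ?mul1r. Qed.

Lemma posZ r h : 0 <= r -> pos h -> pos (r%:C *: h).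
Proof.
move=> r0 [y sy ->]; exists ((Num.sqrt r)%:C *: y); first by rewrite starZr sy.
by rewrite -scalerAl -scalerAr real_scale_comp -(expr2 (Num.sqrt r)) sqr_sqrtr.
Qed.

Lemma posZ_inv r h : 0 < r -> pos (r%:C *: h) -> pos h.
Proof.
move=> r0 /(posZ (ltW (_ : 0 < r^-1))); rewrite invr_gt0 r0 => /(_ isT).
by rewrite real_scale_comp mulVf ?gt_eqF// rmorph1 scale1r.
Qed.

Lemma pos_near1 x : star x = x -> cnorm (1 - x) <= 1 ->
  exists y, [/\ star y = y, cnorm (1 - y) <= 1, x = y * y &
    forall z, GRing.comm z x -> GRing.comm z y].
Proof.
move=> sx nx.
have [|y [sy ny e cy]] := sqrt_one_sub _ nx; first by rewrite starB star1 sx.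
exists (1 - y); split.
- by rewrite starB star1 sy.
- by rewrite opprB addrCA subrr addr0.
- by rewrite e opprB addrCA subrr addr0.
move=> z zx; apply: commrB; first exact: commr1.
by apply: cy; apply: commrB => //; exact: commr1.
Qed.

Lemma pos_of_near1 x : star x = x -> cnorm (1 - x) <= 1 -> pos x.
Proof. by move=> sx /(pos_near1 sx)[y [sy _ xy _]]; exists y. Qed.

Lemma pos_one_sub x : star x = x -> cnorm x <= 1 -> pos (1 - x).
Proof.
move=> sx nx; apply: pos_of_near1; first by rewrite starB star1 sx.
by rewrite opprB addrCA subrr addr0.
Qed.

(** Together with [pos_of_near1], this describes the positive elements of the
    self-adjoint unit ball by the convex condition |1 - h| <= 1, which is what
    makes sums of positive elements positive. If h = y^2 and 1 - h = z^2, then z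
    is the real part of the unitary z + i y. *)
Lemma near1_of_pos h : pos h -> cnorm h <= 1 -> cnorm (1 - h) <= 1.
Proof.
move=> [y sy ->] ny.
have [||z [sz _ e cz]] := pos_near1 (x := 1 - y * y).
- by rewrite starB star1 starM sy.
- by rewrite opprB addrCA subrr addr0.
rewrite e (cnorm_sa sz) expr_le1 ?cnorm_ge0//.
apply: (@commuting_unit_norm z y) => //.
  apply/commr_sym/cz/commrB; [exact: commr1|exact: commrM].
by rewrite -e subrK.
Qed.

Lemma cnorm_unit_scale x t : 0 < t -> cnorm x <= t -> cnorm (t^-1%:C *: x) <= 1.
Proof.
move=> t0 xt; rewrite cnormZr gtr0_norm ?invr_gt0//.
by rewrite -(mulVf (_ : t != 0)) ?gt_eqF// ler_pM2l ?invr_gt0.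
Qed.

Lemma posD h g : pos h -> pos g -> pos (h + g).
Proof.
move=> ph pg; pose t := cnorm h + cnorm g + 1.
have h0 := cnorm_ge0 h; have g0 := cnorm_ge0 g.
have t0 : 0 < t by rewrite /t; lra.
have ti0 : 0 <= t^-1 by rewrite invr_ge0 ltW.
have t2 : 0 < 2^-1 * t^-1 by rewrite mulr_gt0 ?invr_gt0.
have nh : cnorm (1 - t^-1%:C *: h) <= 1.
  by apply: near1_of_pos; [exact: posZ|apply: cnorm_unit_scale => //; rewrite /t; lra].
have ng : cnorm (1 - t^-1%:C *: g) <= 1.
  by apply: near1_of_pos; [exact: posZ|apply: cnorm_unit_scale => //; rewrite /t; lra].
apply: (posZ_inv t2); rewrite -real_scale_comp scalerDr.
apply: pos_of_near1.
  by rewrite starZr starD !starZr (pos_sa ph) (pos_sa pg).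
rewrite -{1}(halfZ 1) -scalerBr opprD addrACA cnormZr ger0_norm ?invr_ge0//.
have := ler_cnormD (1 - t^-1%:C *: h) (1 - t^-1%:C *: g); lra.
Qed.

Lemma pos_sum (I : Type) (r : seq I) (F : I -> A) :
  (forall i, pos (F i)) -> pos (\sum_(i <- r) F i).
Proof.
move=> pF; elim: r => [|i r IH]; first by rewrite big_nil; exact: pos0.
by rewrite big_cons; exact: posD.
Qed.

(** The root is chosen in the bicommutant of h, so that roots and absolute
    values of commuting elements can be multiplied freely. *)
Lemma pos_sqrt h : pos h ->
  exists a, [/\ pos a, a * a = h & forall z, GRing.comm z h -> GRing.comm z a].
Proof.
move=> ph; pose t := cnorm h + 1; have h0 := cnorm_ge0 h.
have t0 : 0 < t by rewrite /t; lra.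
have ti0 : 0 <= t^-1 by rewrite invr_ge0 ltW.
have sx : star (t^-1%:C *: h) = t^-1%:C *: h by rewrite starZr (pos_sa ph).
have [|y [sy ny e cy]] := pos_near1 sx.
  by apply: near1_of_pos; [exact: posZ|apply: cnorm_unit_scale => //; rewrite /t; lra].
exists ((Num.sqrt t)%:C *: y); split.
- by apply: posZ; [exact: sqrtr_ge0|exact: pos_of_near1].
- rewrite -scalerAl -scalerAr real_scale_comp -(expr2 (Num.sqrt t)) sqr_sqrtr ?ltW// -e.
  by rewrite real_scaleK// gt_eqF.
- by move=> z zh; apply/commrZ/cy/commrZ.
Qed.

Lemma pos_mul a b : pos a -> pos b -> GRing.comm a b -> pos (a * b).
Proof.
move=> /pos_sqrt[x [px <- cx]] /pos_sqrt[y [py <- cy]] ab.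
have xb : GRing.comm x (y * y) by exact/commr_sym/cx/commr_sym.
have xy : GRing.comm x y by exact: cy.
exists (x * y); first by apply: sa_mul => //; exact: pos_sa.
by rewrite -!mulrA; congr (_ * _); rewrite !mulrA xy.
Qed.

Lemma pos_anti h : pos h -> pos (- h) -> h = 0.
Proof.
move=> ph pn; have [a [pa ah ca]] := pos_sqrt ph.
have [b [pb bh cb]] := pos_sqrt pn.
have hb : GRing.comm h b by exact/cb/commrN.
have ab : GRing.comm a b by exact/commr_sym/ca/commr_sym.
pose c := a * b.
have sc : star c = c by apply: sa_mul => //; exact: pos_sa.
have hc : GRing.comm h c by apply: commrM => //; exact: ca.
have e : h * h + c * c = 0.
  have -> : c * c = (a * a) * (b * b).
    by rewrite /c -!mulrA; congr (_ * _); rewrite !mulrA ab.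
  by rewrite ah bh mulrN subrr.
have := commuting_sqr_norm (pos_sa ph) sc hc; rewrite e cnorm0.
by rewrite exprn_even_le0//= => /eqP/cnorm0_eq0.
Qed.

Lemma pos_add_eq0 a b : pos a -> pos b -> a + b = 0 -> a = 0.
Proof. by move=> pa pb /eqP; rewrite addr_eq0 => /eqP e; apply: pos_anti; rewrite // e opprK. Qed.

Lemma pos_sum_eq0 (I : finType) (F : I -> A) : (forall i, pos (F i)) ->
  \sum_i F i = 0 -> forall i, F i = 0.
Proof.
move=> pF e i; apply: (pos_add_eq0 (pF i) (b := \sum_(j | j != i) F j)).
  by rewrite -big_filter; exact: pos_sum.
by move: e; rewrite (bigD1 i).
Qed.

Lemma abs_exists h : star h = h -> exists a,
  [/\ pos a, a * a = h * h & forall z, GRing.comm z h -> GRing.comm z a].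
Proof.
move=> sh; have [a [pa e ca]] := pos_sqrt (pos_sqr sh).
by exists a; split=> // z zh; apply: ca; exact: commrM.
Qed.

Lemma sa_cube m : star m = m -> m * m * m = 0 -> m = 0.
Proof.
move=> sm m3; apply: sa_nilp => //; apply: sa_nilp; first by rewrite starM sm.
by rewrite mulrA m3 mul0r.
Qed.

Lemma pos_sqrt_unique a b : pos a -> pos b -> GRing.comm a b ->
  a * a = b * b -> a = b.
Proof.
move=> pa pb ab e; have sa := pos_sa pa; have sb := pos_sa pb.
pose m := a - b; have sm : star m = m by rewrite starB sa sb.
have ma : GRing.comm m a by apply/commr_sym/commrB.
have mb : GRing.comm m b by apply/commr_sym/commrB; first exact/commr_sym.
have pma : pos (m * m * a).
  by apply: pos_mul => //; [exact: pos_sqr|apply/commr_sym/commrM; apply/commr_sym].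
have pmb : pos (m * m * b).
  by apply: pos_mul => //; [exact: pos_sqr|apply/commr_sym/commrM; apply/commr_sym].
have mab : m * (a + b) = 0 by rewrite -sqrB_comm// e subrr.
have e0 : m * m * a + m * m * b = 0 by rewrite -mulrDr -mulrA mab mulr0.
have a0 := pos_add_eq0 pma pmb e0.
have b0 : m * m * b = 0 by move: e0; rewrite a0 add0r.
apply/eqP; rewrite -subr_eq0; apply/eqP/(sa_cube sm).
by rewrite /m mulrBr -/m a0 b0 subrr.
Qed.

(** Here a = |h|, and m = |h| - h is twice the negative part of h. Only the cube
    of m is visibly positive, since m^2 = 2|h|m; this suffices for the
    positivity of x* x. *)
Lemma abs_sub_cube h a : star h = h -> pos a -> a * a = h * h ->
  GRing.comm h a ->
  let m := a - h in
  [/\ star m = m, pos (m * m * m) & h * m * m = - (2^-1%:C *: (m * m * m))].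
Proof.
move=> sh pa e ha m; have sm : star m = m by rewrite starB (pos_sa pa) sh.
have am : GRing.comm a m by apply: commrB => //; exact/commr_sym.
have hm : GRing.comm h m by apply: commrB.
have m2 : m * m = a * m + a * m.
  rewrite {1}/m mulrBl.
  have -> : h * m = - (a * m) by rewrite /m !mulrBr e ha opprB.
  by rewrite opprK.
have pam2 : pos (a * m * m).
  rewrite -mulrA; apply: pos_mul => //; first exact: pos_sqr.
  exact: commrM.
have m3 : m * m * m = a * m * m + a * m * m by rewrite {1}m2 mulrDl.
split=> //; first by rewrite m3; exact: posD.
rewrite m3 halfZ.
have -> : h * m = - (a * m) by rewrite /m !mulrBr e ha opprB.
by rewrite mulNr.
Qed.

End Positive.

(** * Positivity of x* x *)

Section Fukamiya.
Variables (R : realType) (A : cstarAlgType R).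
Implicit Types (a b c g h m s x y z v : A) (r t : R).

(** If x = 1 + d with d > 0, then x^(2n) >= (n d)^2, which beats 1 + 2n. *)
Lemma le1_of_exp2_growth (x : R) : 0 <= x ->
  (forall n, x ^+ (2 ^ n) <= 1 + (2 ^ n)%:R) -> x <= 1.
Proof.
move=> x0 h; rewrite leNgt; apply/negP => x1.
pose d := x - 1; have d0 : 0 < d by rewrite /d subr_gt0.
have bern n : 1 + n%:R * d <= x ^+ n.
  elim: n => [|n IH]; first by rewrite mul0r addr0 expr0.
  rewrite exprS -natr1; have : 0 <= n%:R :> R by exact: ler0n.
  have : x = 1 + d by rewrite /d addrCA subrr addr0.
  by move: (n%:R) (x ^+ n) IH => N y IH -> N0; nra.
have [N] : exists N : nat, 3 / d ^+ 2 < N%:R.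
  have d2 : 0 < 3 / d ^+ 2 by rewrite divr_gt0// exprn_gt0.
  by exists (Num.truncn (3 / d ^+ 2)).+1; apply: truncnS_gt.
rewrite ltr_pdivrMr ?exprn_gt0// => hN.
have NM : (N%:R : R) <= (2 ^ N)%:R by rewrite ler_nat ltnW// ltn_expl.
have := h N.+1; rewrite expnS mulnC exprM natrM.
have := bern (2 ^ N)%N.
have M1 : 1 <= (2 ^ N)%:R :> R by rewrite ler1n expn_gt0.
move: ((2 ^ N)%:R) (x ^+ (2 ^ N)) NM M1 => M y NM M1 hy.
have : (M * d) ^+ 2 <= y ^+ 2.
  by apply: lerXn2r; rewrite ?nnegrE; nra.
rewrite exprMn => h1 h2.
have : M * (3 : R) < M * (M * d ^+ 2).
  rewrite ltr_pM2l; last by lra.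
  by apply: (lt_le_trans hN); rewrite ler_pM2r// exprn_gt0.
lra.
Qed.

Lemma sa_pow2_norm v n : star v = v -> cnorm (v ^+ (2 ^ n)) = cnorm v ^+ (2 ^ n).
Proof.
move=> sv; elim: n => [|n IH]; first by rewrite !expr1.
by rewrite expnS mulnC !exprM -IH expr2 cnorm_sa// starX sv.
Qed.

(** Usually deduced from the fact that z z* and z* z have the same nonzero
    spectrum. Instead, with v = 1 + z z* and w = 1 + z* z, the difference
    v^(n+1) - v^n = z w^n z* has norm at most 1 when |z| <= 1, so the powers of v
    grow at most linearly; as v is self-adjoint, |v^(2^n)| = |v|^(2^n), which
    forces |v| <= 1. *)
Lemma neg_swap z : pos (- (star z * z)) -> pos (- (z * star z)).
Proof.
wlog nz : z / cnorm z <= 1 => [hw pn|pn].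
  pose t := cnorm z + 1; have t0 : 0 < t by rewrite /t; have := cnorm_ge0 z; lra.
  have ti : 0 < t^-1 by rewrite invr_gt0.
  have e x y : (t^-1%:C *: x) * (t^-1%:C *: y) = (t^-1 * t^-1)%:C *: (x * y).
    by rewrite -scalerAl -scalerAr real_scale_comp.
  have := hw (t^-1%:C *: z); rewrite starZr !e -!scalerN => hw'.
  have tt : 0 < t^-1 * t^-1 by rewrite mulr_gt0.
  apply: (posZ_inv tt); apply: hw'; last by apply: posZ => //; exact: ltW.
  by apply: cnorm_unit_scale => //; rewrite /t; lra.
pose v := 1 + z * star z; pose w := 1 + star z * z.
have sg : star (z * star z) = z * star z by rewrite starM starK.
have sv : star v = v by rewrite starD star1 sg.
have nw : cnorm w <= 1.
  have := near1_of_pos pn; rewrite opprK; apply.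
  by rewrite cnormN cnorm_cstar expr_le1 ?cnorm_ge0.
have zw n : z * w ^+ n = v ^+ n * z.
  elim: n => [|n IH]; first by rewrite mulr1 mul1r.
  have zw1 : z * w = v * z by rewrite mulrDl mulrDr mul1r mulr1 mulrA.
  by rewrite exprS mulrA zw1 -mulrA IH mulrA -exprS.
have hw n : cnorm (w ^+ n) <= 1.
  elim: n => [|n IH]; first by rewrite cnorm1.
  rewrite exprS; apply: le_trans (ler_cnormM _ _) _.
  by rewrite mulr_ile1 ?cnorm_ge0.
have hv n : cnorm (v ^+ n) <= 1 + n%:R.
  elim: n => [|n IH]; first by rewrite cnorm1 addr0.
  have e : v ^+ n.+1 = v ^+ n + z * w ^+ n * star z.
    by rewrite exprSr mulrDr mulr1 zw mulrA.
  rewrite e -natr1; apply: le_trans (ler_cnormD _ _) _.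
  rewrite addrA; apply: lerD => //.
  apply: le_trans (ler_cnormM _ _) _; rewrite cnorm_star mulr_ile1 ?cnorm_ge0//.
  by apply: le_trans (ler_cnormM _ _) _; rewrite mulr_ile1 ?cnorm_ge0.
have nv : cnorm v <= 1.
  by apply: le1_of_exp2_growth => [|n]; rewrite ?cnorm_ge0// -sa_pow2_norm.
by apply: pos_of_near1; rewrite ?starN ?sg// opprK.
Qed.

(** z* z + z z* is twice the sum of the squares of the real and imaginary parts
    of z, so z* z is positive as soon as - z z* is; being also negative, it is 0. *)
Lemma neg_star_mul z : pos (- (star z * z)) -> z = 0.
Proof.
move=> pn; have pn' := neg_swap pn; pose i : R[i] := Complex 0 1.
have ii : i * i = -1 by rewrite -expr2 sqr_i.
have ci : Num.conj i = - i by exact: conj_i.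
pose p := z + star z; pose q := i *: (z - star z).
have sp : star p = p by rewrite starD starK addrC.
have sq : star q = q.
  by rewrite starZ starB starK ci scaleNr -scalerN opprB.
have e : p * p + q * q = (star z * z + z * star z) + (star z * z + z * star z).
  rewrite /q -scalerAl -scalerAr scalerA ii scaleN1r.
  have -> : p * p = (z * z + star z * star z) + (star z * z + z * star z).
    rewrite mulrDl !mulrDr (addrC (star z * z)) addrACA.
    by rewrite (addrC (z * star z)).
  have -> : (z - star z) * (z - star z) =
      (z * z + star z * star z) - (star z * z + z * star z).
    rewrite mulrBl !mulrBr opprB addrACA -opprD.
    by rewrite (addrC (z * star z)).
  by rewrite opprB addrC addrA subrK.
have pz : pos (star z * z).
  rewrite -[star z * z](addrK (z * star z)); apply: posD => //.
  rewrite -[X in pos X]halfZ -e; apply: posZ; first by rewrite invr_ge0.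
  by apply: posD; exact: pos_sqr.
apply: cnorm0_eq0; apply/eqP; rewrite -sqrf_eq0 -cnorm_cstar.
by rewrite (pos_anti pz pn) cnorm0.
Qed.

(** For h = x* x and m = |h| - h, the element z = x m has z* z = - m^3 / 2, hence
    vanishes; so m^3 = 0, m = 0 and h = |h|. *)
Lemma pos_star_mul x : pos (star x * x).
Proof.
pose h := star x * x; have sh : star h = h by rewrite starM starK.
have [a [pa e ca]] := abs_exists sh.
have ha : GRing.comm h a by exact: ca.
have /= := abs_sub_cube sh pa e ha; set m := a - h => -[sm pm hm].
have mh : m * h = h * m by exact/commr_sym/commrB.
have z0 : x * m = 0.
  apply: neg_star_mul; rewrite starM sm !mulrA -(mulrA m) mh hm opprK.
  by apply: posZ => //; rewrite invr_ge0.
suff : m = 0 by move/eqP; rewrite subr_eq0 -/h => /eqP <-.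
apply: sa_cube => //.
have : h * m * m = 0 by rewrite /h -(mulrA _ x m) z0 mulr0 mul0r.
rewrite hm => /eqP; rewrite oppr_eq0 scaler_eq0 => /orP[|/eqP//].
by rewrite eq_complex /= invr_eq0 pnatr_eq0.
Qed.

Lemma pos_commuting_unit_norm s : pos s -> pos (1 - s) -> cnorm s <= 1.
Proof.
move=> ps /pos_sqrt[b [pb bs cb]]; have [a [pa as_ ca]] := pos_sqrt ps.
rewrite -as_ (cnorm_sa (pos_sa pa)) expr_le1 ?cnorm_ge0//.
apply: (commuting_unit_norm (g := b)); rewrite ?pos_sa//.
  apply/cb/commrB; first exact: commr1.
  by apply: commr_sym; rewrite /GRing.comm -as_ mulrA.
by rewrite as_ bs addrC subrK.
Qed.

Lemma cnorm_le1_between b : star b = b -> pos (1 - b) -> pos (1 + b) -> cnorm b <= 1.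
Proof.
move=> sb p1 p2.
have : pos ((1 - b) * (1 + b)).
  apply: pos_mul => //; apply/commrD; first exact: commr1.
  by apply/commr_sym/commrB => //; exact: commr1.
rewrite -sqrB_comm ?mul1r; last exact/commr_sym/commr1.
move=> /pos_sqrt[c [pc e cc]].
apply: (commuting_unit_norm (g := c)) => //; first exact: pos_sa.
  by apply/cc/commrB; [exact: commr1|exact: commrM].
by rewrite e addrC subrK.
Qed.

(** Division by the invertible positive element s, without constructing its
    inverse: the negative part m of h satisfies h m^2 = - m^3 / 2, so m^3 s is
    both positive and negative, and s >= 2 gives m^3 = 0. *)
Lemma pos_cancel h s : star h = h -> pos (s - (1 + 1)) -> GRing.comm h s ->
  pos (h * s) -> pos h.
Proof.
move=> sh ps hs phs.
have [a [pa e ca]] := abs_exists sh.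
have ha : GRing.comm h a by exact: ca.
have /= := abs_sub_cube sh pa e ha; set m := a - h => -[sm pm hm].
have mh : GRing.comm m h by exact/commr_sym/commrB.
have sm_ : GRing.comm s m.
  by apply/commrB; [apply/ca/commr_sym|apply/commr_sym].
have p2 : pos (1 + 1 : A) by apply: posD; apply: pos1.
have s2 : pos s by rewrite -(subrK (1 + 1) s); exact: posD.
have hmm : h * (m * m) = m * m * h by apply: commrM; exact/commr_sym.
have sm3 : GRing.comm (m * m * m) s by apply/commr_sym; do !apply: commrM.
have pm3s : pos (m * m * m * s) by exact: pos_mul.
have e0 : m * m * m * s = 0.
  apply: pos_anti => //; apply: (@posZ_inv _ _ 2^-1); first by rewrite invr_gt0.
  rewrite scalerN scalerAl -mulNr -hm -!mulrA.
  have -> : h * (m * (m * s)) = (m * m) * (h * s).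
    by rewrite (mulrA m m s) (mulrA h) hmm -!mulrA.
  apply: pos_mul => //; first exact: pos_sqr.
  by apply/commrM; apply/commr_sym/commrM => //; exact/commr_sym.
suff : m * m * m = 0 by move/(sa_cube sm)/eqP; rewrite subr_eq0 => /eqP <-.
apply: (pos_add_eq0 pm pm); rewrite -{1 2}(mulr1 (m * m * m)) -mulrDr.
apply: pos_anti.
  by apply: pos_mul => //; apply: commrD; exact: commr1.
rewrite -mulrN.
have -> : m * m * m * - (1 + 1) = m * m * m * (s - (1 + 1)).
  by rewrite (mulrBr (m * m * m) s) e0 sub0r mulrN.
apply: pos_mul => //; apply: commrB => //; apply: commrD; exact: commr1.
Qed.

End Fukamiya.

(** * Order between commuting elements *)

Section Clamp.
Variables (R : realType) (A : cstarAlgType R).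
Implicit Types (a b c h g m p q s t x y z v : A).

Lemma sqrD_comm a b : GRing.comm a b ->
  (a + b) * (a + b) = a * a + b * b + (a * b + a * b).
Proof.
by move=> ab; rewrite mulrDl !mulrDr -ab (addrC (a * b) (b * b)) addrACA.
Qed.

Lemma pos_abs_sub h a : star h = h -> pos a -> a * a = h * h ->
  GRing.comm h a -> pos (a - h).
Proof.
move=> sh pa e ha; pose m := a - h.
have sm : star m = m by rewrite starB (pos_sa pa) sh.
have am : GRing.comm a m by apply: commrB => //; exact/commr_sym.
have m2 : m * m = a * m + a * m.
  rewrite {1}/m mulrBl.
  have -> : h * m = - (a * m) by rewrite /m !mulrBr e ha opprB.
  by rewrite opprK.
have [n [pn en cn]] := abs_exists sm.
have mn : GRing.comm m n by exact: cn.
have an : GRing.comm a n by exact: cn.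
have := abs_sub_cube sm pn en mn; set k := n - m => /= -[sk pk mk].
have ak : GRing.comm a k by exact: commrB.
have mk_ : GRing.comm m k by exact: commrB.
have e1 : m * m * (k * k) = - (a * (k * k * k)).
  rewrite m2 mulrDl -!(mulrA a) !(mulrA m) mk mulrN -scalerAr -opprD.
  by rewrite -scalerDr halfZ.
have mk0 : m * k = 0.
  apply: sa_nilp; first exact: sa_mul.
  have -> : m * k * (m * k) = m * m * (k * k).
    by rewrite -!mulrA; congr (_ * _); rewrite !mulrA mk_.
  apply: pos_anti; last first.
    rewrite e1 opprK; apply: pos_mul => //; by do !apply: commrM.
  apply: pos_mul; [exact: pos_sqr|exact: pos_sqr|].
  by apply: commrM; apply/commr_sym/commrM; apply/commr_sym.
suff : k = 0 by move/eqP; rewrite subr_eq0 -/m => /eqP <-.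
apply: sa_cube => //; have : m * k * k = 0 by rewrite mk0 mul0r.
rewrite mk => /eqP; rewrite oppr_eq0 scaler_eq0 => /orP[|/eqP//].
by rewrite eq_complex /= invr_eq0 pnatr_eq0.
Qed.

(** The scalar inequality |t + 2| <= |t| + 2 for elements, with p = |t + 2| and
    q = |t|: since (q + 2)^2 - p^2 = 4 (|t| - t) is positive, so is its factor
    q + 2 - p. *)
Lemma abs_shift t p q : star t = t -> pos p -> pos q ->
  q * q = t * t -> p * p = (t + (1 + 1)) * (t + (1 + 1)) ->
  GRing.comm t q -> GRing.comm t p -> GRing.comm p q ->
  pos (q + (1 + 1) - p).
Proof.
move=> st pp pq eq ep tq tp pq_.
have p2 : pos (1 + 1 : A) by apply: posD; apply: pos1.
have c2 x : GRing.comm x (1 + 1 : A) by apply: commrD; exact: commr1.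
have cq2p : GRing.comm (q + (1 + 1)) p.
  by apply/commr_sym/commrD => //; exact: c2.
apply: (@pos_cancel _ _ _ (q + (1 + 1) + p)).
- by rewrite starB !starD !star1 !(pos_sa pp) (pos_sa pq).
- by rewrite addrAC addrK; apply: posD.
- apply/commr_sym/commrB; apply/commr_sym/commrD => //.
rewrite -sqrB_comm// ep !sqrD_comm// eq opprD addrACA subrr add0r opprD addrACA.
rewrite -mulrBl; have pm : pos (q - t) by exact: pos_abs_sub.
by apply: posD; apply: pos_mul.
Qed.

Lemma re_im_parts x : exists a b : A, [/\ star a = a, star b = b,
  x = a + Complex 0 1 *: b, cnorm a <= cnorm x & cnorm b <= cnorm x].
Proof.
pose i : R[i] := Complex 0 1.
have ii : i * i = -1 by rewrite -expr2 sqr_i.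
have ci : Num.conj i = - i by exact: conj_i.
have ni : normc i = 1 by rewrite /normc /= expr0n add0r expr1n sqrtr1.
exists (2^-1%:C *: (x + star x)), (2^-1%:C *: (i *: (star x - x))).
have nx y : cnorm y = cnorm x -> cnorm (2^-1%:C *: (x + y)) <= cnorm x.
  move=> e; rewrite cnormZr ger0_norm ?invr_ge0//.
  have := ler_cnormD x y; rewrite e; lra.
split.
- by rewrite starZr starD starK addrC.
- by rewrite starZr starZ starB starK ci scaleNr -scalerN opprB.
- rewrite scalerA mulrC -scalerA (scalerA i) ii scaleN1r opprB -scalerDr.
  by rewrite addrACA subrr addr0 halfZ.
- by apply: nx; rewrite cnorm_star.
rewrite scalerA mulrC -scalerA cnormZ ni mul1r addrC -cnormN -scalerN opprD opprK.
by apply: nx; rewrite cnormN cnorm_star.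
Qed.

End Clamp.

(** * Homomorphisms are contractive and have closed range *)

Section StarHom.
Variables (R : realType) (A B : cstarAlgType R) (f : starHom A B).
Implicit Types (a h x y : A) (b : B).

Lemma starHom_pos h : pos h -> pos (f h).
Proof. by case=> y sy ->; exists (f y); rewrite -?starhomP ?sy// rmorphM. Qed.

(** If |x| <= 1, then 1 - x* x is a square, hence so is its image, and
    0 <= f(x* x) <= 1. *)
Lemma starHom_contractive x : cnorm (f x) <= cnorm x.
Proof.
have unit y : cnorm y <= 1 -> cnorm (f y) <= 1.
  move=> ny; rewrite -(@expr_le1 _ 2)// ?cnorm_ge0// -cnorm_cstar -starhomP -rmorphM.
  apply: pos_commuting_unit_norm; first exact/starHom_pos/pos_star_mul.
  rewrite -(rmorph1 f) -rmorphB; apply/starHom_pos/pos_one_sub.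
    by rewrite starM starK.
  by rewrite cnorm_cstar expr_le1 ?cnorm_ge0.
have [->|/eqP x0] := pselect (x = 0); first by rewrite rmorph0 !cnorm0.
have nx : 0 < cnorm x.
  rewrite lt_neqAle cnorm_ge0 andbT eq_sym; apply: contra x0 => /eqP.
  by move/cnorm0_eq0 ->.
have := unit _ (cnorm_unit_scale nx (lexx _)).
rewrite linearZ /= cnormZr gtr0_norm ?invr_gt0// mulrC ler_pdivrMr// mul1r.
by [].
Qed.

(** Homomorphisms commute with absolute values because positive square roots are
    unique; hence truncations of a preimage are preimages of truncations. *)
Lemma starHom_abs h a b : star h = h -> pos a -> a * a = h * h ->
  GRing.comm h a -> f h = b -> pos b -> f a = b.
Proof.
move=> sh pa e ha <- pfh; apply: pos_sqrt_unique => //.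
- exact: starHom_pos.
- by rewrite /GRing.comm -!rmorphM ha.
- by rewrite -!rmorphM e.
Qed.

Lemma sa_lift a : exists h, star h = h /\ (star (f a) = f a -> f h = f a).
Proof.
exists (2^-1%:C *: (a + star a)); split.
  by rewrite starZr starD starK addrC.
by move=> sfa; rewrite linearZ /= raddfD /= starhomP sfa halfZ.
Qed.

Lemma range_pos_root b : range f b -> pos b -> exists2 y, pos y & f (y * y) = b.
Proof.
move=> [x _ <-] pb; have [h [sh /(_ (pos_sa pb)) fh]] := sa_lift x.
have [a [pa e ca]] := abs_exists sh.
have fa := starHom_abs sh pa e (ca _ erefl) fh pb.
by have [y [py ey _]] := pos_sqrt pa; exists y; rewrite ?ey.
Qed.

(** Truncate a self-adjoint preimage h to [-1, 1] by the formula
    (|h + 1| - |h - 1|) / 2, which does not move elements of norm at most 1. *)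
Lemma lift_sa_unit b : range f b -> star b = b -> cnorm b <= 1 ->
  exists2 a, f a = b & cnorm a <= 1.
Proof.
move=> [x _ <-] sb nb; have [h [sh /(_ sb) fh]] := sa_lift x.
have c1 y : GRing.comm y 1 by exact: commr1.
have shp : star (h + 1) = h + 1 by rewrite starD sh star1.
have shm : star (h - 1) = h - 1 by rewrite starB sh star1.
have [p [pp ep cp]] := abs_exists shp.
have [q [pq eq cq]] := abs_exists shm.
have hp : GRing.comm h p by apply/cp/commrD.
have hq : GRing.comm h q by apply/cq/commrB.
have qp : GRing.comm q p by apply/cp/commrD => //; exact/commr_sym.
have fp : f p = f x + 1.
  apply: (starHom_abs shp) => //; first by exact: cp.
    by rewrite rmorphD rmorph1 /= fh.
  apply: pos_of_near1; first by rewrite starD sb star1.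
  by rewrite opprD addrCA subrr addr0 cnormN.
have fq : f q = 1 - f x.
  have shm' : star (1 - h) = 1 - h by rewrite starB sh star1.
  apply: (starHom_abs shm') => //.
  - by rewrite eq -[h - 1]opprB mulrNN.
  - by apply/commr_sym/commrB => //; exact/commr_sym.
  - by rewrite rmorphB rmorph1 /= fh.
  by apply: pos_one_sub.
have pq2 : pos (q + (1 + 1) - p).
  apply: (abs_shift shm) => //.
  - by rewrite ep addrA subrK.
  - by exact: cq.
  - by apply/commr_sym/commrB => //; exact/commr_sym.
have shm' : star (- (h + 1)) = - (h + 1) by rewrite starN shp.
have pp2 : pos (p + (1 + 1) - q).
  apply: (abs_shift shm') => //.
  - by rewrite ep mulrNN.
  - have -> : - (h + 1) + (1 + 1) = - (h - 1).
      by rewrite opprD opprB addrA addrNK addrC.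
    by rewrite eq mulrNN.
  - by apply/commr_sym/commrN/commr_sym/cp.
  - by apply/commr_sym/commrN/commrD => //; exact/commr_sym.
exists (2^-1%:C *: (p - q)).
  by rewrite linearZ /= raddfB /= fp fq opprB addrACA subrr addr0 halfZ.
apply: cnorm_le1_between.
- by rewrite starZr starB (pos_sa pp) (pos_sa pq).
- rewrite -{1}(halfZ 1) -scalerBr; apply: posZ; first by rewrite invr_ge0.
  by rewrite opprB addrA (addrC (1 + 1)).
- rewrite -{1}(halfZ 1) -scalerDr; apply: posZ; first by rewrite invr_ge0.
  by rewrite addrA (addrC (1 + 1)).
Qed.

Lemma lift_bounded b : range f b ->
  exists2 a, f a = b & cnorm a <= 2 * cnorm b.
Proof.
have sa_case c : range f c -> star c = c -> exists2 a, f a = c & cnorm a <= cnorm c.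
  move=> [x _ fx] sc; have [->|/eqP c0] := pselect (c = 0).
    by exists 0; rewrite ?rmorph0// !cnorm0.
  have nc : 0 < cnorm c.
    rewrite lt_neqAle cnorm_ge0 andbT eq_sym; apply: contra c0 => /eqP.
    by move/cnorm0_eq0 ->.
  have [|||a fa na] := @lift_sa_unit ((cnorm c)^-1%:C *: c).
  - by exists ((cnorm c)^-1%:C *: x) => //; rewrite linearZ /= fx.
  - by rewrite starZr sc.
  - exact: cnorm_unit_scale.
  exists ((cnorm c)%:C *: a).
    by rewrite linearZ /= fa real_scaleK// gt_eqF.
  by rewrite cnormZr gtr0_norm// ler_piMr// ltW.
move=> [x _ <-]; have [u [v [su sv e nu nv]]] := re_im_parts (f x).
have [r [s [sr ss e' _ _]]] := re_im_parts x.
have [fr fs] : f r = u /\ f s = v.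
  have hu : f r + Complex 0 1 *: f s = u + Complex 0 1 *: v.
    by rewrite -e e' raddfD /= linearZ.
  have hs : f r - Complex 0 1 *: f s = u - Complex 0 1 *: v.
    have := congr1 star hu; rewrite !starD !starZ -!starhomP su sv sr ss conj_i.
    by rewrite !scaleNr.
  have fru : f r = u.
    rewrite -(halfZ (f r)) -(halfZ u); congr (_ *: _).
    have : (f r + Complex 0 1 *: f s) + (f r - Complex 0 1 *: f s) =
           (u + Complex 0 1 *: v) + (u - Complex 0 1 *: v) by rewrite hu hs.
    by rewrite [LHS]addrACA [RHS]addrACA !subrr !addr0.
  split=> //; move: hu; rewrite fru => /addrI.
  move/(congr1 ( *:%R (Complex 0 (-1)))); rewrite !scalerA.
  have -> : Complex 0 (-1) * Complex 0 1 = 1 :> R[i].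
    by apply/eqP; rewrite eq_complex /= !(mul0r, mulr0, mulN1r, opprK, mulr1, addr0, subr0, add0r) !eqxx.
  by rewrite !scale1r.
have [|a fa na] := sa_case u _ su; first by exists r.
have [|b' fb nb] := sa_case v _ sv; first by exists s.
exists (a + Complex 0 1 *: b'); first by rewrite raddfD /= linearZ /= fa fb -e.
apply: le_trans (ler_cnormD _ _) _; rewrite cnormZ.
have -> : normc (Complex 0 1 : R[i]) = 1 by rewrite /normc expr0n add0r expr1n sqrtr1.
lra.
Qed.

(** A convergent sequence in the range, with fast decreasing increments, is lifted
    increment by increment with control of the norms, using [lift_bounded]. *)
Lemma range_closed b :
  (forall e : R, 0 < e -> exists2 y, range f y & cnorm (y - b) < e) -> range f b.
Proof.
move=> hb; have hb' n : exists y : B, range f y /\ cnorm (y - b) < 2^-1 ^+ n.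
  have [|y] := hb (2^-1 ^+ n); first by rewrite exprn_gt0// invr_gt0.
  by exists y.
pose y n := projT1 (cid (hb' n)).
have yr n : range f (y n) by rewrite /y; case: cid => ? [].
have yb n : cnorm (y n - b) < 2^-1 ^+ n by rewrite /y; case: cid => ? [].
have hc n : exists c, f c = y n.+1 - y n /\ cnorm c <= 4 * 2^-1 ^+ n.
  have [|c fc nc] := @lift_bounded (y n.+1 - y n).
    have [[u _ <-] [v _ <-]] := (yr n.+1, yr n).
    by exists (u - v) => //; rewrite raddfB.
  exists c; split=> //; apply: le_trans nc _.
  have := cnorm_dist (y n.+1) b (y n); rewrite (cnormBC b).
  have := yb n; have := yb n.+1; rewrite exprS.
  have : 0 < (2^-1 : R) ^+ n by rewrite exprn_gt0// invr_gt0.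
  by move: (_ ^+ n) (cnorm _) (cnorm _) (cnorm _) => *; lra.
pose c n := projT1 (cid (hc n)).
have fc n : f (c n) = y n.+1 - y n by rewrite /c; case: cid => ? [].
have nc n : cnorm (c n) <= 4 * 2^-1 ^+ n by rewrite /c; case: cid => ? [].
have [x0 _ fx0] := yr 0%N.
pose a n := x0 + \sum_(i < n) c i.
have fa n : f (a n) = y n.
  elim: n => [|n IH]; first by rewrite /a big_ord0 addr0.
  by rewrite /a big_ord_recr /= addrA raddfD /= -/(a n) IH fc addrCA subrr addr0.
have ad n k : cnorm (a (n + k)%N - a n) <= 8 * (2^-1 ^+ n - 2^-1 ^+ (n + k)).
  elim: k => [|k IH]; first by rewrite addn0 !subrr cnorm0 mulr0.
  have e : a (n + k).+1 - a (n + k)%N = c (n + k)%N.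
    by rewrite /a big_ord_recr /= opprD addrACA subrr add0r addrC addrA addNr add0r.
  rewrite addnS; have := cnorm_dist (a (n + k).+1) (a (n + k)%N) (a n).
  rewrite e (exprS _ (n + k)); have := nc (n + k)%N; move: IH.
  by move: (_ ^+ (n + k)) (_ ^+ n) (cnorm _) (cnorm _) (cnorm _) => *; lra.
have hpow : null (fun n => 8 * 2^-1 ^+ n : R).
  apply: nullZ => // e e0.
  exists (Num.truncn (e^-1)).+1 => n hn.
  have ne : e^-1 < n%:R.
    by apply: lt_le_trans (truncnS_gt _) _; rewrite ler_nat.
  have n2 : (n%:R : R) <= 2 ^+ n by rewrite -natrX ler_nat ltnW// ltn_expl.
  rewrite exprVn invf_plt ?posrE// ?exprn_gt0//; exact: lt_le_trans n2.
have [l hl] : exists l, cto a l.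
  apply: cauchy_cto => e /hpow[N /(_ N (leqnn N)) hN]; exists N => n Nn.
  rewrite -(subnKC Nn); apply: le_lt_trans (ad _ _) _.
  apply: le_lt_trans hN; rewrite ler_pM2l// lerBlDr lerDl.
  by rewrite exprn_ge0// invr_ge0.
exists l => //; apply: (@cto_unique _ _ y).
  have h : null (fun n => cnorm (a n - l)) by [].
  apply: null_le h => n /=.
  by rewrite -fa -raddfB; exact: starHom_contractive.
move=> e e0; have e8 : 0 < 8 * e by rewrite mulr_gt0.
have [N hN] := hpow _ e8; exists N => n /hN; have := yb n.
by move: (_ ^+ n) (cnorm _) => *; lra.
Qed.

End StarHom.

(** * Sub-C*-algebras *)

Section SubAlgebra.
Variables (R : realType) (A : cstarAlgType R).

(** Norm-closed unital *-subalgebras. The type built from one serves twice: a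
    homomorphism from Q_p into it shows that Q_p is generated by U and S, and it
    makes the restriction of chi_k to the gauge-invariant part a homomorphism of
    C*-algebras, to which [range_closed] applies. *)
Record sub_cstar (X : set A) : Prop := SubCStar {
  sub_cstar1 : X 1;
  sub_cstarP : forall (c : R[i]) x y, X x -> X y -> X (c *: x + y);
  sub_cstarM : forall x y, X x -> X y -> X (x * y);
  sub_cstar_star : forall x, X x -> X (star x);
  sub_cstar_lim : forall (y : nat -> A) l, (forall n, X (y n)) -> cto y l -> X l
}.

Variables (X : set A) (hX : sub_cstar X).

Definition sub_mem (_ : sub_cstar X) : {pred A} := fun x => `[< X x >].

Fact sub_mem_closed : GRing.subalg_closed (sub_mem hX).
Proof.
split; first by apply/asboolP; exact: sub_cstar1.
- move=> c x y /asboolP hx /asboolP hy; apply/asboolP; exact: sub_cstarP.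
- move=> x y /asboolP hx /asboolP hy; apply/asboolP; exact: sub_cstarM.
Qed.

HB.instance Definition _ :=
  GRing.isSubalgClosed.Build R[i] A (sub_mem hX) sub_mem_closed.

Record sub_cstarType := SubElt { sub_val : A; sub_valP : sub_val \in sub_mem hX }.

HB.instance Definition _ := [isSub for sub_val].
HB.instance Definition _ := [Choice of sub_cstarType by <:].
HB.instance Definition _ := [SubChoice_isSubAlgebra of sub_cstarType by <:].

Lemma sub_valX (x : sub_cstarType) : X (val x).
Proof. exact/asboolP/(valP x). Qed.

Definition sub_elt x (Xx : X x) : sub_cstarType := @SubElt x (asboolT Xx).

Definition sub_star (x : sub_cstarType) : sub_cstarType :=
  sub_elt (sub_cstar_star hX (sub_valX x)).
Definition sub_norm (x : sub_cstarType) : R := cnorm (val x).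

Fact sub_starK : involutive sub_star.
Proof. by move=> x; apply: val_inj; rewrite /= starK. Qed.

Fact sub_starP (c : R[i]) x y :
  sub_star (c *: x + y) = Num.conj c *: sub_star x + sub_star y.
Proof. by apply: val_inj; rewrite /= starP. Qed.

Fact sub_starM x y : sub_star (x * y) = sub_star y * sub_star x.
Proof. by apply: val_inj; rewrite /= starM. Qed.

Fact sub_norm0_eq0 x : sub_norm x = 0 -> x = 0.
Proof. by move=> /cnorm0_eq0 h; apply: val_inj. Qed.

Fact sub_normZ (c : R[i]) x : sub_norm (c *: x) = normc c * sub_norm x.
Proof. exact: cnormZ. Qed.

Fact sub_normD x y : sub_norm (x + y) <= sub_norm x + sub_norm y.
Proof. exact: ler_cnormD. Qed.

Fact sub_normM x y : sub_norm (x * y) <= sub_norm x * sub_norm y.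
Proof. exact: ler_cnormM. Qed.

Fact sub_norm_cstar x : sub_norm (sub_star x * x) = sub_norm x ^+ 2.
Proof. exact: cnorm_cstar. Qed.

Fact sub_complete (x : nat -> sub_cstarType) :
  (forall e : R, 0 < e -> exists N : nat, forall m n : nat,
       (N <= m)%N -> (N <= n)%N -> sub_norm (x m - x n) < e) ->
  exists l, forall e : R, 0 < e -> exists N : nat, forall n : nat,
      (N <= n)%N -> sub_norm (x n - l) < e.
Proof.
move=> hx; have [l hl] := @cnorm_complete _ A (fun n => val (x n)) hx.
have Xl : X l by apply: (sub_cstar_lim hX) hl => n; exact: sub_valX.
by exists (sub_elt Xl).
Qed.

HB.instance Definition _ := isCStarAlgebra.Build R sub_cstarType
  sub_starK sub_starP sub_starM sub_norm0_eq0 sub_normZ sub_normD sub_normM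
  sub_norm_cstar sub_complete.

Definition sub_fun (x : sub_cstarType) : A := sub_val x.

HB.instance Definition _ := GRing.isLinear.Build R[i] sub_cstarType A _ sub_fun
  (fun c x y => erefl).
HB.instance Definition _ := GRing.isMonoidMorphism.Build sub_cstarType A sub_fun
  (conj erefl (fun x y => erefl)).

Definition sub_incl : starHom sub_cstarType A :=
  @StarHom _ sub_cstarType A (GRing.LRMorphism.clone _ _ _ _ sub_fun _)
    (fun=> erefl).

End SubAlgebra.

Definition starHom_comp (R : realType) (A B C : cstarAlgType R)
    (g : starHom B C) (f : starHom A B) : starHom A C :=
  @StarHom _ A C (GRing.LRMorphism.clone _ _ _ _ (g \o f) _)
    (fun x => etrans (congr1 g (starhomP f x)) (starhomP g (f x))).

(** * Roots of unity *)

Section RootsOfUnity.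
Variable R : realType.
Implicit Types (t : R) (z : R[i]) (N n : nat) (m : int).

Definition cis t : R[i] := Complex (cos t) (sin t).

Lemma cisD t1 t2 : cis (t1 + t2) = cis t1 * cis t2.
Proof.
by rewrite /cis cosD sinD; apply/eqP; rewrite eq_complex /= eqxx /= addrC.
Qed.

Lemma cis0 : cis 0 = 1.
Proof. by rewrite /cis cos0 sin0. Qed.

Lemma cisX t n : cis t ^+ n = cis (n%:R * t).
Proof.
elim: n => [|n IH]; first by rewrite mul0r cis0.
by rewrite exprS IH -cisD -natr1 mulrDl mul1r addrC.
Qed.

Lemma norm_cis t : `|cis t| = 1.
Proof. by rewrite normc_def /= cos2Dsin2 sqrtr1. Qed.

Lemma cis2pi : cis (pi *+ 2) = 1.
Proof. by rewrite /cis cos2pi sin2pi. Qed.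

Lemma cis_neq1 t : 0 < t < pi *+ 2 -> cis t != 1.
Proof.
move=> /andP[t0 t1]; apply/eqP => -[c1 _].
have h : 0 < sin (t / 2).
  apply: sin_gt0_pi; rewrite divr_gt0//= ltr_pdivrMr//.
  by rewrite mulr_natr.
have : cos (t / 2 + t / 2) = 1 by rewrite (_ : t / 2 + t / 2 = t)//; lra.
rewrite cosD -!expr2 cos2sin2 => /eqP.
have : 0 < sin (t / 2) ^+ 2 by rewrite exprn_gt0.
move: (_ ^+ 2) => x x0 /eqP; lra.
Qed.

Definition prim_root N : R[i] := cis (pi *+ 2 / N%:R).

Lemma prim_rootX N : (0 < N)%N -> prim_root N ^+ N = 1.
Proof.
by move=> N0; rewrite cisX mulrC divfK ?pnatr_eq0 -?lt0n// cis2pi.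
Qed.

Lemma norm_prim_root N : `|prim_root N| = 1.
Proof. exact: norm_cis. Qed.

Lemma norm_prim_rootX N n : `|prim_root N ^+ n| = 1.
Proof. by rewrite normrX norm_prim_root expr1n. Qed.

Lemma prim_root_neq1 N n : (0 < n < N)%N -> prim_root N ^+ n != 1.
Proof.
move=> /andP[n0 nN]; rewrite cisX; apply: cis_neq1.
have N0 : (0 < N)%N by exact: leq_trans nN.
have p2 : 0 < pi *+ 2 :> R by rewrite mulrn_wgt0 ?pi_gt0.
rewrite !mulr_gt0 ?invr_gt0 ?ltr0n//= mulrCA.
by rewrite gtr_pMr// ltr_pdivrMr ?ltr0n// mul1r ltr_nat.
Qed.

Lemma unit_modulus z : `|z| = 1 -> z != 0.
Proof. by move=> z1; rewrite -normr_eq0 z1 oner_eq0. Qed.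

Lemma conj_unit_modulus z : `|z| = 1 -> Num.conj z = z^-1.
Proof. by move=> z1; rewrite [RHS]invC_norm z1 expr1n invr1 mul1r. Qed.

Lemma normc_unit z : `|z| = 1 -> normc z = 1.
Proof. by move=> /(@complexI R). Qed.

Lemma prim_root_eq1 N m : (0 < N)%N -> (prim_root N ^ m == 1) = (N%:Z %| m)%Z.
Proof.
move=> N0; have Nn : N%:Z != 0 by rewrite eqz_nat -lt0n.
have z0 := unit_modulus (norm_prim_root N).
rewrite {1}(divz_eq m N) expfzDr// mulrC -(mulrC N%:Z) -exprz_exp.
have -> : prim_root N ^ N%:Z = 1 by exact: prim_rootX.
rewrite exp1rz mulr1.
have h1 : (0 <= m %% N)%Z by exact: modz_ge0.
have h2 : (m %% N < N)%Z by exact: ltz_pmod.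
apply/eqP/dvdz_mod0P; last by move=> ->.
move: h1 h2; case: (m %% N)%Z => // -[//|r] _ h2 h.
have := @prim_root_neq1 N r.+1; rewrite ltz_nat in h2; rewrite h2 /=.
by move=> /(_ isT)/eqP; case.
Qed.

Lemma sum_prim_root N m : (0 < N)%N ->
  \sum_(t < N) (prim_root N ^+ t) ^ m = if (N%:Z %| m)%Z then N%:R else 0.
Proof.
move=> N0; set w := prim_root N.
have e (i : nat) : (w ^+ i) ^ m = (w ^ m) ^+ i.
  by rewrite -[w ^+ i]/(w ^ i%:Z) exprzAC.
under eq_bigr do rewrite e.
have := prim_root_eq1 m N0; rewrite -/w; case: ifP => _.
  move=> /eqP ->; under eq_bigr do rewrite expr1n.
  by rewrite sumr_const card_ord.
move=> /negbT h; apply: (mulfI (_ : w ^ m - 1 != 0)); first by rewrite subr_eq0.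
rewrite -subrX1 mulr0 -[(w ^ m) ^+ N]/((w ^ m) ^ N%:Z) exprzAC.
have -> : w ^ N%:Z = 1 by exact: prim_rootX.
by rewrite exp1rz subrr.
Qed.

Lemma normc_complex_le (a b : R) : normc (Complex a b) <= `|a| + `|b|.
Proof.
have -> : Complex a b = a%:C + Complex 0 1 * b%:C.
  by apply/eqP; rewrite eq_complex /= !(mul0r, mulr0, mul1r, subr0, addr0, add0r) !eqxx.
apply: le_trans (le_normcD _ _) _; rewrite normcM !normcR.
by rewrite /normc expr0n add0r expr1n sqrtr1 mul1r.
Qed.

Lemma cis_continuous t (e : R) : 0 < e ->
  exists2 d, 0 < d & forall x, `|x - t| < d -> normc (cis x - cis t) < e.
Proof.
move=> e0; have e2 : 0 < e / 2 by rewrite divr_gt0.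
have /cvgrPdist_lt hc : cos x @[x --> t] --> cos t by exact: continuous_cos.
have /nbhs_ballP[d1 /= d10 h1] := hc _ e2.
have /cvgrPdist_lt hs : sin x @[x --> t] --> sin t by exact: continuous_sin.
have /nbhs_ballP[d2 /= d20 h2] := hs _ e2.
exists (Num.min d1 d2); first by rewrite lt_min d10.
move=> x; rewrite lt_min distrC => /andP[/h1 a /h2 b].
apply: le_lt_trans (normc_complex_le _ _) _.
rewrite distrC (distrC (sin x)); move: a b => /=; lra.
Qed.

(** Round the angle 2 pi j / K to a multiple of 2 pi / p^n. *)
Lemma prim_root_approx (p K j : nat) : (2 <= p)%N -> (0 < K)%N ->
  exists w : nat -> R[i], [/\ forall n, `|w n| = 1, forall n, w n ^+ (p ^ n) = 1
    & null (fun n => normc (w n - prim_root K ^+ j))].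
Proof.
move=> p2 K0; pose a n := ((j * p ^ n) %/ K)%N.
have pn0 n : (0 < p ^ n)%N by rewrite expn_gt0 (leq_trans _ p2).
exists (fun n => prim_root (p ^ n) ^+ a n); split.
- by move=> n; rewrite cisX norm_cis.
- by move=> n; rewrite exprAC prim_rootX// expr1n.
move=> e e0; rewrite cisX.
have [d d0 hd] := cis_continuous (j%:R * (pi *+ 2 / K%:R)) e0.
have pi2 : 0 < pi *+ 2 :> R by rewrite mulrn_wgt0 ?pi_gt0.
exists (Num.truncn (pi *+ 2 / d)).+1 => n hn; rewrite cisX; apply: hd.
have Pn : 0 < (p ^ n)%:R :> R by rewrite ltr0n.
have KR : 0 < K%:R :> R by rewrite ltr0n.
have nP : pi *+ 2 / d < (p ^ n)%:R.
  apply: lt_le_trans (truncnS_gt _) _; rewrite ler_nat.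
  by apply: leq_trans hn _; rewrite ltnW// ltn_expl.
have -> : (a n)%:R * (pi *+ 2 / (p ^ n)%:R) - j%:R * (pi *+ 2 / K%:R) =
   - (((j * p ^ n) %% K)%:R / K%:R) * (pi *+ 2 / (p ^ n)%:R) :> R.
  have e1 : (a n)%:R * K%:R + ((j * p ^ n) %% K)%:R = j%:R * (p ^ n)%:R :> R.
    by rewrite -!natrM -natrD -divn_eq.
  have -> : ((j * p ^ n) %% K)%:R = j%:R * (p ^ n)%:R - (a n)%:R * K%:R :> R.
    by rewrite -e1 addrC addKr.
  by field; rewrite !gt_eqF.
rewrite mulNr normrN ger0_norm; last first.
  by apply: mulr_ge0; apply: divr_ge0; rewrite ?ler0n// ltW.
apply: (@le_lt_trans _ _ (1 * (pi *+ 2 / (p ^ n)%:R))).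
  rewrite ler_pM2r ?divr_gt0// ler_pdivrMr// mul1r ler_nat ltnW//.
  by rewrite ltn_pmod.
by rewrite mul1r ltr_pdivrMr// mulrC -ltr_pdivrMr.
Qed.

Lemma expz_cvg (w : nat -> R[i]) z m : (forall n, `|w n| = 1) -> `|z| = 1 ->
  null (fun n => normc (w n - z)) -> null (fun n => normc (w n ^ m - z ^ m)).
Proof.
move=> w1 z1 wz.
have pow k : null (fun n => normc (w n ^+ k - z ^+ k)).
  elim: k => [|k IH].
    by apply: null_le (@null0 R) => n; rewrite !expr0 subrr normc0.
  apply: null_le (nullD IH wz) => n /=.
  have -> : w n ^+ k.+1 - z ^+ k.+1 =
      w n * (w n ^+ k - z ^+ k) + (w n - z) * z ^+ k.
    by rewrite mulrBr mulrBl -!exprS addrA addrNK.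
  apply: le_trans (le_normcD _ _) _; rewrite !normcM normc_unit//.
  by rewrite [normc (z ^+ k)]normc_unit ?normrX ?z1 ?expr1n// mul1r mulr1.
case: m => k; first exact: pow.
apply: null_le (pow k.+1) => n.
rewrite !NegzE -!invr_expz -![(_ ^ k.+1%:Z)]/(_ ^+ k.+1).
rewrite -!conj_unit_modulus ?normrX ?w1 ?z1 ?expr1n// -rmorphB.
move: (_ - _) => -[x y]; by rewrite /normc /= sqrrN.
Qed.

End RootsOfUnity.

(** * Consequences of the p-adic relations *)

Lemma coprimez_exp (k : int) (p n : nat) :
  coprimez k p -> coprimez k (p ^ n)%N.
Proof. by move=> kp; rewrite coprimezE /= coprimeXr// -[p]/(`|p%:Z|%N) -coprimezE. Qed.

Section PadicRelations.
Variables (R : realType) (A : cstarAlgType R).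
Implicit Types (u s t : A) (p q n : nat) (i j k m : int).

Definition shifted_proj u s i := upow u i * s * star s * upow u (- i).

Lemma padic_rel_sum p u s : padic_rel p u s ->
  \sum_(l < p) shifted_proj u s l%:Z = 1.
Proof. by case. Qed.

Lemma padic_rel_mul p q u s t : padic_rel p u s -> padic_rel q u t ->
  padic_rel (p * q) u (s * t).
Proof.
move=> [u1 u2 s1 su hs] [_ _ t1 tu ht]; split => //.
- by rewrite starM -mulrA (mulrA (star s)) s1 mul1r.
- rewrite -mulrA tu mulrA.
  have -> : s * u ^+ q = (u ^+ q) ^+ p * s := upow_comm u1 u2 su q%:Z.
  by rewrite -exprM mulnC mulrA.
have e : \sum_(l < p * q) shifted_proj u (s * t) l%:Z =
    \sum_(j < q) \sum_(i < p) shifted_proj u (s * t) (i%:Z + j%:Z * p%:Z).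
  rewrite -(big_mkord xpredT (fun l => shifted_proj u (s * t) l%:Z)) mulnC.
  rewrite big_nat_mul big_mkord; apply: eq_bigr => j _.
  rewrite -{1}[(j * p)%N]add0n big_addn mulSn addnK big_mkord.
  by apply: eq_bigr => i _; rewrite PoszD PoszM.
rewrite -[LHS]/(\sum_(l < p * q) shifted_proj u (s * t) l%:Z) e exchange_big /=.
rewrite -[RHS]hs; apply: eq_bigr => i _.
transitivity (upow u i%:Z * s * (\sum_(j < q) shifted_proj u t j%:Z) * star s
  * upow u (- i%:Z)); last by rewrite (padic_rel_sum (And5 u1 u2 t1 tu ht)) mulr1.
rewrite mulr_sumr !mulr_suml; apply: eq_bigr => j _.
have c k : s * upow u k = upow u (k * p%:Z) * s.
  by rewrite (upow_comm u1 u2 su) upowMn.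
have c' k : upow u (- k) * star s = star s * upow u (- (k * p%:Z)).
  by rewrite !upowN// -!starM c.
rewrite /shifted_proj starM upow_add// [in upow u (- _)]addrC opprD upow_add//.
by rewrite !mulrA -(mulrA _ s (upow u j)) c -!mulrA (mulrA (upow u (- j%:Z))) c' !mulrA.
Qed.

(** Thanks to this, every identity about one level n of the cylinder projections
    is the case n = 1 for the pair (u, s^n). *)
Lemma padic_rel_exp p n u s : padic_rel p u s -> padic_rel (p ^ n) u (s ^+ n).
Proof.
move=> h; elim: n => [|n IH].
  case: h => u1 u2 _ _ _; rewrite expn0 expr0; split; rewrite ?star1 ?mul1r//.
    by rewrite expr1 mulr1.
  by rewrite big_ord_recl big_ord0 /= addr0 ?star1 !mulr1.
by rewrite expnS exprS; exact: padic_rel_mul.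
Qed.

Section OneLevel.
Variables (p : nat) (u s : A).
Hypothesis h : padic_rel p u s.

Let u1 : star u * u = 1. Proof. by case: h. Qed.
Let u2 : u * star u = 1. Proof. by case: h. Qed.
Let s1 : star s * s = 1. Proof. by case: h. Qed.
Let su : s * u = u ^+ p * s. Proof. by case: h. Qed.

Let D k m := upow_add u1 u2 k m.
Let N k := upowN u k.

Lemma mul_isom_upow k : s * upow u k = upow u (k * p%:Z) * s.
Proof. by rewrite (upow_comm u1 u2 su) upowMn. Qed.

Lemma mul_upow_coisom k : upow u k * star s = star s * upow u (k * p%:Z).
Proof.
have := congr1 star (mul_isom_upow (- k)).
by rewrite !starM mulNr !N !starK.
Qed.

Lemma rel_gt0 : (0 < p)%N.
Proof.
case: h => _ _ _ _; case: p => // /eqP.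
by rewrite big_ord0 eq_sym oner_eq0.
Qed.

(** Sandwiching the sum of the projections u^l s s* u^-l between s* and s gives
    1 = sum_l y_l y_l* with y_l = s* u^l s and y_0 = 1; the other summands are
    positive with sum 0. *)
Lemma isom_upow_isom0 k : (0 <= k < p%:Z) -> k != 0 -> star s * upow u k * s = 0.
Proof.
have p0 := rel_gt0.
case: k => // k; rewrite ltz_nat => /andP[_ kp] k0.
pose y (l : 'I_p) := star s * upow u l%:Z * s.
pose l0 : 'I_p := Ordinal p0; pose lk : 'I_p := Ordinal kp.
have e : \sum_(l < p) y l * star (y l) = 1.
  rewrite -[RHS]s1 -[X in _ = _ * X]mul1r -(padic_rel_sum h) mulr_suml mulr_sumr.
  apply: eq_bigr => l _.
  by rewrite /y /shifted_proj !starM starK N !mulrA.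
have y0 : y l0 * star (y l0) = 1 by rewrite /y /= mulr1 s1 mul1r star1.
have : \sum_(l < p) (if l == l0 then 0 else y l * star (y l)) = 0.
  move: e; rewrite (bigD1 l0)//= y0 -[X in _ = X]addr0 => /addrI e.
  rewrite (bigD1 l0)//= ?eqxx add0r -[RHS]e; apply: eq_bigr => l /negbTE -> //.
move/pos_sum_eq0 => /(_ _ lk); rewrite ifN; last first.
  by apply/eqP => -[] kk; rewrite kk in k0.
move=> hy; apply: cnorm0_eq0; rewrite -cnorm_star; apply/eqP.
rewrite -sqrf_eq0 -cnorm_cstar starK hy ?cnorm0// => l.
case: ifP => _; first exact: pos0.
by rewrite -{1}(starK (y l)); exact: pos_star_mul.
Qed.

Lemma isom_upow_isom m :
  star s * upow u m * s = if (p%:Z %| m)%Z then upow u (m %/ p%:Z)%Z else 0.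
Proof.
have p0 := rel_gt0; have pn : p%:Z != 0 by rewrite eqz_nat -lt0n.
rewrite {1}(divz_eq m p) D !mulrA -mul_upow_coisom -!mulrA (mulrA (star s)).
case: ifP => [/dvdz_mod0P ->|/negbT hm]; first by rewrite /= mulr1 s1 mulr1.
rewrite isom_upow_isom0 ?mulr0//.
  by rewrite modz_ge0//= ltz_pmod.
by apply: contra hm => /eqP e; apply/dvdz_mod0P.
Qed.

Local Notation e := (shifted_proj u s).

Lemma shifted_proj_periodic i : e (i + p%:Z) = e i.
Proof.
have c : upow u p%:Z * s = s * upow u 1 by rewrite mul_isom_upow mul1r.
have c' : star s * upow u (- p%:Z) = upow u (-1) * star s.
  by rewrite mul_upow_coisom mulN1r.
have e1 : upow u (- (i + p%:Z)) = upow u (- p%:Z) * upow u (- i).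
  by rewrite opprD addrC D.
rewrite /shifted_proj e1 D -!(mulrA (upow u i)) c -!mulrA (mulrA (star s)) c'.
by rewrite -!mulrA (mulrA (upow u 1)) -D subrr mul1r.
Qed.

Lemma shifted_proj_periodicM i k : e (i + k * p%:Z) = e i.
Proof.
have pos (n : nat) j : e (j + n%:Z * p%:Z) = e j.
  elim: n => [|n IH]; first by rewrite mul0r addr0.
  by rewrite -addn1 PoszD mulrDl mul1r addrA shifted_proj_periodic.
case: k => n //; rewrite NegzE mulNr -[LHS](pos n.+1) subrK.
by [].
Qed.

Lemma shifted_proj_mod i j : (p%:Z %| j - i)%Z -> e i = e j.
Proof.
move=> /dvdzP[k hk]; rewrite -(shifted_proj_periodicM i k) -hk.
by rewrite addrCA subrr addr0.
Qed.

Lemma star_shifted_proj i : star (e i) = e i.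
Proof. by rewrite /shifted_proj N !starM !starK -N !mulrA. Qed.

Lemma upow_shifted_proj k i : upow u k * e i = e (i + k) * upow u k.
Proof.
rewrite /shifted_proj !mulrA -D addrC -[RHS]mulrA -D opprD subrK.
by [].
Qed.

Lemma shifted_proj_mul i j :
  e i * e j = if (p%:Z %| j - i)%Z then e i else 0.
Proof.
have -> : e i * e j =
    upow u i * s * (star s * upow u (j - i) * s) * star s * upow u (- j).
  by rewrite addrC D /shifted_proj !mulrA.
rewrite isom_upow_isom; case: ifP => [hd|_]; last by rewrite mulr0 !mul0r.
rewrite (shifted_proj_mod hd) /shifted_proj -(mulrA (upow u i)) mul_isom_upow divzK//.
by rewrite mulrA -D addrCA subrr addr0.
Qed.

Lemma sum_shifted_proj k i : coprimez k p ->
  \sum_(l < p) e (i + k * l%:Z) = 1.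
Proof.
move=> kp; have := padic_rel_sum (padic_rel_chi kp h).
have uk1 := upowVK u1 u2 k; have uk2 := upowK u1 u2 k.
move=> hs; rewrite -[RHS](upowK u1 u2 i) -[X in _ = X * _]mulr1 -hs.
rewrite mulr_sumr mulr_suml; apply: eq_bigr => l _.
have -> : shifted_proj (upow u k) s l%:Z = e (k * l%:Z).
  rewrite /shifted_proj !upowN upowMn//.
rewrite upow_shifted_proj -mulrA (upowK u1 u2) mulr1 addrC.
by [].
Qed.

End OneLevel.

Section TwoLevels.
Variables (p : nat) (u s : A).
Hypothesis h : padic_rel p u s.

(** These projections play the role of the indicators of the cosets i + p^n Z_p
    of the p-adic integers, on which u acts by x |-> x + 1. *)
Definition cyl n i := shifted_proj u (s ^+ n) i.

Let u1 : star u * u = 1. Proof. by case: h. Qed.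
Let u2 : u * star u = 1. Proof. by case: h. Qed.
Let D k m := upow_add u1 u2 k m.
Let N k := upowN u k.
Let hn n := padic_rel_exp n h.

Lemma coisom_upow_isom a b m : (b <= a)%N ->
  star (s ^+ b) * upow u m * s ^+ a = 0 \/
  exists r, m = r * (p ^ b)%:Z /\
    star (s ^+ b) * upow u m * s ^+ a = upow u r * s ^+ (a - b).
Proof.
move=> ba; rewrite -(subnKC ba) exprD mulrA (isom_upow_isom (hn b)).
case: ifP => [hd|_]; last by left; rewrite mul0r.
by right; exists (m %/ (p ^ b)%:Z)%Z; rewrite divzK// addKn.
Qed.

Lemma cyl_mul_le n (m : nat) i j : (n <= m)%N -> cyl n i * cyl m j = 0 \/ cyl n i * cyl m j = cyl m j.
Proof.
move=> nm.
have e : cyl n i * cyl m j = upow u i * s ^+ n *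
    (star (s ^+ n) * upow u (j - i) * s ^+ m) * star (s ^+ m) * upow u (- j).
  by rewrite addrC D /cyl /shifted_proj !mulrA.
have [e0|[r [hr er]]] := coisom_upow_isom (j - i) nm.
  by left; rewrite e e0 mulr0 !mul0r.
right; rewrite e er -!(mulrA (upow u i)) [s ^+ n * _]mulrA (mul_isom_upow (hn n)) -hr.
by rewrite -[_ * s ^+ n * s ^+ (m - n)]mulrA -exprD subnKC// !mulrA -D addrCA subrr addr0.
Qed.

(** For n <= m the product of two cylinder projections is 0 or the finer one. *)
Lemma cyl_comm n (m : nat) i j : GRing.comm (cyl n i) (cyl m j).
Proof.
wlog nm : n m i j / (n <= m)%N => [hw|].
  by have [/hw//|/ltnW/hw hc] := leqP n m; exact/commr_sym.
have st (l : nat) i' : star (cyl l i') = cyl l i'.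
  exact: star_shifted_proj.
have e : cyl m j * cyl n i = star (cyl n i * cyl m j) by rewrite starM !st.
rewrite /GRing.comm e; have [->|->] := cyl_mul_le i j nm; by rewrite ?star0 ?st.
Qed.

End TwoLevels.

End PadicRelations.

(** * Closed linear spans *)

Section Span.
Variables (R : realType) (A : cstarAlgType R).
Implicit Types (G X : set A) (x y g : A).

Inductive lspan G : A -> Prop :=
| lspan0 : lspan G 0
| lspanP : forall (c : R[i]) g x, G g -> lspan G x -> lspan G (c *: g + x).

Definition adh X x := forall e : R, 0 < e -> exists2 y, X y & cnorm (y - x) < e.

Lemma lspan_gen G g : G g -> lspan G g.
Proof. by move=> Gg; rewrite -[g]addr0 -[g]scale1r; apply: lspanP => //; exact: lspan0. Qed.

Lemma lspanD G x y : lspan G x -> lspan G y -> lspan G (x + y).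
Proof.
by move=> sx sy; elim: sx => [|c g z Gg _ IH]; rewrite ?add0r// -addrA; exact: lspanP.
Qed.

Lemma lspanZ G (c : R[i]) x : lspan G x -> lspan G (c *: x).
Proof.
elim=> [|d g z Gg _ IH]; first by rewrite scaler0; exact: lspan0.
by rewrite scalerDr scalerA; exact: lspanP.
Qed.

Lemma lspan_star G : (forall g, G g -> lspan G (star g)) ->
  forall x, lspan G x -> lspan G (star x).
Proof.
move=> h x; elim=> [|c g z Gg _ IH]; first by rewrite star0; exact: lspan0.
by rewrite starP; apply: lspanD => //; apply/lspanZ/h.
Qed.

Lemma lspan_mul G : (forall g g', G g -> G g' -> lspan G (g * g')) ->
  forall x y, lspan G x -> lspan G y -> lspan G (x * y).
Proof.
move=> h x y sx sy; elim: sx => [|c g z Gg _ IH]; first by rewrite mul0r; exact: lspan0.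
rewrite mulrDl; apply: lspanD => //; rewrite -scalerAl; apply: lspanZ.
elim: sy => [|d g' z' Gg' _ IH']; first by rewrite mulr0; exact: lspan0.
by rewrite mulrDr -scalerAr; apply: lspanD => //; apply/lspanZ/h.
Qed.

Lemma adh_sub X x : X x -> adh X x.
Proof. by move=> Xx e e0; exists x => //; rewrite subrr cnorm0. Qed.

Lemma adhP X x : adh X x -> exists2 y : nat -> A, forall n, X (y n) & cto y x.
Proof.
move=> h; have h' n : exists y, X y /\ cnorm (y - x) < n.+1%:R^-1.
  by have [|y] := h n.+1%:R^-1; [rewrite invr_gt0|exists y].
exists (fun n => projT1 (cid (h' n))) => [n|e e0]; first by case: cid => ? [].
exists (Num.truncn e^-1).+1 => n hn; case: cid => y /= [_] hy.
apply: lt_le_trans hy _; rewrite invf_ple ?posrE// ltW//.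
apply: lt_le_trans (truncnS_gt _) _; rewrite ler_nat; exact: leqW.
Qed.

Lemma cto_adh X (y : nat -> A) x : (forall n, X (y n)) -> cto y x -> adh X x.
Proof. by move=> hX hy e /hy[N /(_ N (leqnn N))]; exists (y N). Qed.

Lemma adh_adh X x : adh (adh X) x -> adh X x.
Proof.
move=> h e e0; have e2 : 0 < e / 2 by rewrite divr_gt0.
have [y /(_ _ e2)[z Xz zy] yx] := h _ e2; exists z => //.
have := cnorm_dist z y x; lra.
Qed.

Lemma sub_cstar_adh_lspan G : G 1 -> (forall g, G g -> lspan G (star g)) ->
  (forall g g', G g -> G g' -> lspan G (g * g')) -> sub_cstar (adh (lspan G)).
Proof.
move=> G1 Gs Gm; split.
- by apply/adh_sub/lspan_gen.
- move=> c x y /adhP[x' hx' x'x] /adhP[y' hy' y'y].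
  apply: cto_adh (ctoD (ctoZ c x'x) y'y) => n.
  by apply: lspanD => //; exact: lspanZ.
- move=> x y /adhP[x' hx' x'x] /adhP[y' hy' y'y].
  by apply: cto_adh (ctoM x'x y'y) => n; exact: lspan_mul.
- move=> x /adhP[x' hx' x'x].
  by apply: cto_adh (cto_star x'x) => n; exact: lspan_star.
- by move=> y l hy yl; apply/adh_adh/(cto_adh hy).
Qed.

End Span.

(** * Dense subalgebras of Q_p and of its gauge-invariant part *)

Lemma starHom_upow (R : realType) (A B : cstarAlgType R) (f : starHom A B)
    (u : A) (k : int) : f (upow u k) = upow (f u) k.
Proof. by case: k => n; rewrite /= rmorphXn /= ?starhomP. Qed.

Definition starHom_id (R : realType) (A : cstarAlgType R) : starHom A A :=
  @StarHom _ A A (GRing.LRMorphism.clone _ _ _ _ idfun _) (fun=> erefl).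

Lemma padic_rel_reflect (R : realType) (A B : cstarAlgType R) (f : starHom A B)
    (p : nat) (u s : A) : injective f -> padic_rel p (f u) (f s) -> padic_rel p u s.
Proof.
move=> fi [u1 u2 s1 su hs]; split; apply: fi.
- by rewrite rmorphM /= starhomP u1 rmorph1.
- by rewrite rmorphM /= starhomP u2 rmorph1.
- by rewrite rmorphM /= starhomP s1 rmorph1.
- by rewrite !rmorphM /= rmorphXn /= su.
rewrite rmorph1 -hs raddf_sum; apply: eq_bigr => l _.
by rewrite /= !rmorphM /= starHom_upow starhomP rmorphXn.
Qed.

Section Averages.
Variables (R : realType) (A : cstarAlgType R).
Implicit Types (N t : nat) (T : nat -> A -> A) (x y c : A).

Definition avg N T x : A := N%:R^-1 *: \sum_(t < N) T t x.

Lemma avg_linear N T (c : R[i]) x y :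
  (forall t x y, T t (c *: x + y) = c *: T t x + T t y) ->
  avg N T (c *: x + y) = c *: avg N T x + avg N T y.
Proof.
move=> h; rewrite /avg scalerA mulrC -scalerA -scalerDr; congr (_ *: _).
by rewrite scaler_sumr -big_split /=; apply: eq_bigr => t _; exact: h.
Qed.

Lemma cnorm_avg N T x (C : R) : (0 < N)%N ->
  (forall t, (t < N)%N -> cnorm (T t x) <= C) -> cnorm (avg N T x) <= C.
Proof.
move=> N0 hT; have NR : 0 < N%:R :> R by rewrite ltr0n.
rewrite /avg (_ : N%:R^-1 = (N%:R^-1)%:C); last by rewrite fmorphV rmorph_nat.
rewrite cnormZr gtr0_norm ?invr_gt0// mulrC ler_pdivrMr//.
apply: le_trans (ler_cnorm_sum _ _) _.
apply: le_trans (ler_sum _ (fun (t : 'I_N) _ => hT t (ltn_ord t))) _.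
by rewrite sumr_const card_ord mulr_natr lexx.
Qed.

Lemma avg_fixed N T x : (0 < N)%N -> (forall t, T t x = x) -> avg N T x = x.
Proof.
move=> N0 hT; rewrite /avg; under eq_bigr do rewrite hT.
rewrite sumr_const card_ord.
by rewrite -(scaler_nat N x) scalerA mulVf ?scale1r// pnatr_eq0 -lt0n.
Qed.

Lemma avg_scale N T x (z : nat -> R[i]) : (forall t, T t x = z t *: x) ->
  avg N T x = (N%:R^-1 * \sum_(t < N) z t) *: x.
Proof.
by move=> hT; rewrite /avg; under eq_bigr do rewrite hT; rewrite -scaler_suml scalerA.
Qed.

Lemma avg_prim_root N T x (m : int) : (0 < N)%N ->
  (forall t, T t x = (prim_root R N ^+ t) ^ m *: x) ->
  avg N T x = if (N%:Z %| m)%Z then x else 0.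
Proof.
move=> N0 hT; rewrite (avg_scale _ hT) sum_prim_root//.
case: ifP => _; last by rewrite mulr0 scale0r.
by rewrite mulVf ?scale1r// pnatr_eq0 -lt0n.
Qed.

(** Averaging contractions that fix y does not move an approximation of y away. *)
Lemma cnorm_avg_sub N T x y : (0 < N)%N ->
  (forall t x y, T t (-1 *: x + y) = -1 *: T t x + T t y) ->
  (forall t x, (t < N)%N -> cnorm (T t x) <= cnorm x) ->
  (forall t, T t y = y) -> cnorm (avg N T x - y) <= cnorm (x - y).
Proof.
move=> N0 hl hc hy.
have e : avg N T x - y = - avg N T (-1 *: x + y).
  by rewrite avg_linear// (avg_fixed N0 hy) scaleN1r opprD opprK.
have e' : x - y = - (-1 *: x + y) by rewrite scaleN1r opprD opprK.
by rewrite e e' !cnormN; apply: cnorm_avg => // t; exact: hc.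
Qed.

Lemma dvdz_small N (m : int) : (`|m| < N)%N -> (N%:Z %| m)%Z = (m == 0).
Proof.
move=> mN; apply/idP/eqP => [|->]; last exact: dvdz0.
rewrite dvdzE absz_nat; case: m mN => -[|n] //= nN; rewrite gtnNdvd//.
Qed.

(** An element of a span involves finitely many generators, so the order of
    averaging from which they all are good can be chosen uniformly. *)
Lemma span_eventually (G H : set A) (T : nat -> A -> A) x :
  (forall M (c : R[i]) x y, T M (c *: x + y) = c *: T M x + T M y) ->
  (forall g, G g -> exists M0, forall M, (M0 <= M)%N -> lspan H (T M g)) ->
  lspan G x -> exists M0, forall M, (M0 <= M)%N -> lspan H (T M x).
Proof.
move=> hT hG; elim=> [|c g y Gg _ [M1 h1]].
  exists 0%N => M _; have := hT M (-1) 0 0.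
  by rewrite scaler0 addr0 scaleN1r addNr => ->; exact: lspan0.
have [M2 h2] := hG _ Gg; exists (maxn M1 M2) => M; rewrite geq_max => /andP[a b].
by rewrite hT; apply: lspanD; [apply/lspanZ/h2|apply: h1].
Qed.

End Averages.

Section Generation.
Variables (R : realType) (p : nat) (Q : padicRingAlg R p).
Implicit Types (a b n : nat) (i j k m : int) (x y c g : Q).

Local Notation U := (padic_U Q).
Local Notation S := (padic_S Q).
Local Notation h := (padic_relP Q).

Let u1 : star U * U = 1. Proof. by case: h. Qed.
Let u2 : U * star U = 1. Proof. by case: h. Qed.
Let D k m := upow_add u1 u2 k m.
Let N k := upowN U k.

(** The universal map from Q_p to the subalgebra X, followed by the inclusion, is
    the identity by the uniqueness in the universal property. *)
Lemma padic_generated (X : set Q) : sub_cstar X -> X U -> X S -> forall x, X x.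
Proof.
move=> hX XU XS; pose i := sub_incl hX.
have ii : injective i by exact: val_inj.
have hr : padic_rel p (sub_elt hX XU) (sub_elt hX XS).
  by apply: (padic_rel_reflect ii); exact: h.
have [f [fU fS _]] := padic_univ Q hr.
have [g [_ _ gu]] := padic_univ Q h.
move=> x; have -> : x = i (f x); last exact: sub_valX.
rewrite -[LHS]/(starHom_id Q x) (gu (starHom_id Q))//.
by rewrite -(gu (starHom_comp i f)) //= ?fU ?fS.
Qed.

Definition mono a b i j : Q := upow U i * S ^+ a * star (S ^+ b) * upow U j.

Definition monos : set Q := [set x | exists a b i j, x = mono a b i j].

Lemma star_mono a b i j : star (mono a b i j) = mono b a (- j) (- i).
Proof. by rewrite /mono !starM starK -!N !mulrA. Qed.

Lemma mono_mul a b i j a' b' i' j' :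
  mono a b i j * mono a' b' i' j' = 0 \/ monos (mono a b i j * mono a' b' i' j').
Proof.
wlog ba : a b i j a' b' i' j' / (b <= a')%N => [hw|].
  have [/hw//|/ltnW ba] := leqP b a'.
  rewrite -[X in X = 0]starK -[X in monos X]starK starM !star_mono.
  have [->|[x1 [x2 [x3 [x4 ->]]]]] := hw b' a' (- j') (- i') b a (- j) (- i) ba.
    by left; rewrite star0.
  by right; rewrite star_mono; exists x2, x1, (- x4), (- x3).
have -> : mono a b i j * mono a' b' i' j' = upow U i * S ^+ a *
    (star (S ^+ b) * upow U (j + i') * S ^+ a') * star (S ^+ b') * upow U j'.
  by rewrite D /mono !mulrA.
have [->|[r [_ ->]]] := coisom_upow_isom h (j + i') ba.
  by left; rewrite mulr0 !mul0r.
right; exists (a + (a' - b))%N, b', (i + r * (p ^ a)%:Z), j'.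
rewrite /mono D exprD -!(mulrA (upow U i)) (mulrA (S ^+ a)).
by rewrite (mul_isom_upow (padic_rel_exp a h)) !mulrA.
Qed.

(** The monomials U^i S^a S*^b U^j are stable under products up to 0, as
    S*^b U^m S^a simplifies. *)
Lemma monos_dense x : adh (lspan monos) x.
Proof.
apply: padic_generated.
- apply: sub_cstar_adh_lspan.
  + by exists 0%N, 0%N, 0, 0; rewrite /mono /= star1 !mulr1.
  + move=> _ [a [b [i [j ->]]]]; rewrite star_mono; apply: lspan_gen.
    by exists b, a, (- j), (- i).
  + move=> _ _ [a [b [i [j ->]]]] [a' [b' [i' [j' ->]]]].
    have [->|] := mono_mul a b i j a' b' i' j'; first exact: lspan0.
    exact: lspan_gen.
- apply/adh_sub/lspan_gen; exists 0%N, 0%N, 1, 0.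
  by rewrite /mono /= star1 !mulr1.
- apply/adh_sub/lspan_gen; exists 1%N, 0%N, 0, 0.
  by rewrite /mono /= star1 !mulr1 mul1r.
Qed.

Local Notation e := (cyl U S).

(** The products of cylinder projections and powers of U span the algebraic
    crossed product of the locally constant functions on Z_p by translation;
    its closure is the Bunce-Deddens algebra. *)
Definition core_gens : set Q := [set x | exists n i m, x = e n i * upow U m].

Lemma gauge_mono (z : R[i]) (z1 : `|z| = 1) a b i j :
  gauge Q z1 (mono a b i j) = z ^ (a%:Z - b%:Z) *: mono a b i j.
Proof.
have [gU gS] := gaugeP Q z1; have z0 := unit_modulus z1.
rewrite /mono !rmorphM /= !starHom_upow starhomP !rmorphXn /= gU gS.
rewrite !exprZn starZ rmorphXn /= conj_unit_modulus//.
rewrite -!scalerAr -!scalerAl !scalerA; congr (_ *: _).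
by rewrite expfzDr// -invr_expz -exprVn mulrC.
Qed.

End Generation.

Arguments monos {R p} Q.
Arguments core_gens {R p} Q.

Section FixedPoints.
Variables (R : realType) (p : nat) (Q : padicRingAlg R p).
Implicit Types (a b n : nat) (i j k m : int) (x y c g : Q).

Local Notation U := (padic_U Q).
Local Notation S := (padic_S Q).
Local Notation h := (padic_relP Q).

Let u1 : star U * U = 1. Proof. by case: h. Qed.
Let u2 : U * star U = 1. Proof. by case: h. Qed.
Let D k m := upow_add u1 u2 k m.
Local Notation e := (cyl U S).

Lemma gauge_fixed_sub : sub_cstar (gauge_fixed Q).
Proof.
split.
- by move=> z z1; rewrite rmorph1.
- by move=> c x y hx hy z z1; rewrite linearP /= hx hy.
- by move=> x y hx hy z z1; rewrite rmorphM /= hx hy.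
- by move=> x hx z z1; rewrite starhomP hx.
move=> y l hy yl z z1; apply: (@cto_unique _ _ y) => //.
apply: null_le (yl : null _) => n /=.
rewrite -[y n](hy n z z1) -raddfB; apply: le_trans (starHom_contractive _ _) _.
by rewrite hy.
Qed.

Lemma mono_fixed a i j : gauge_fixed Q (mono Q a a i j).
Proof. by move=> z z1; rewrite gauge_mono subrr scale1r. Qed.

Lemma upow_fixed k : gauge_fixed Q (upow U k).
Proof.
have -> : upow U k = mono Q 0 0 k 0 by rewrite /mono /= star1 !mulr1.
exact: mono_fixed.
Qed.

Lemma cyl_upow_mono n i m : e n i * upow U m = mono Q n n i (m - i).
Proof. by rewrite /mono addrC D /cyl /shifted_proj !mulrA. Qed.

Lemma core_gen_fixed n i m : gauge_fixed Q (e n i * upow U m).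
Proof. by rewrite cyl_upow_mono; exact: mono_fixed. Qed.

Lemma cyl_fixed n i : gauge_fixed Q (e n i).
Proof. by rewrite -[e n i]mulr1 -[1]/(upow U 0); exact: core_gen_fixed. Qed.

Definition gauge_root (M t : nat) : Q -> Q :=
  gauge Q (norm_prim_rootX R M t).

(** Averaging the gauge action over the roots of unity of a large order kills the
    monomials with a <> b in an approximation of x, and does not move x. *)
Lemma core_dense x : gauge_fixed Q x -> adh (lspan (core_gens Q)) x.
Proof.
move=> hx eps eps0; have [y ys yx] := monos_dense x eps0.
have glin M t (c : R[i]) y1 y2 :
  gauge_root M t (c *: y1 + y2) = c *: gauge_root M t y1 + gauge_root M t y2.
  by rewrite /gauge_root linearP.
pose T M := avg M.+1 (gauge_root M.+1).
have [M hM] : exists M0, forall M, (M0 <= M)%N -> lspan (core_gens Q) (T M y).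
  apply: span_eventually ys; first by move=> *; exact: avg_linear.
  move=> _ [a [b [i [j ->]]]]; exists (`|a%:Z - b%:Z|)%N => M hM.
  have -> : T M (mono Q a b i j) =
      if (M.+1%:Z %| a%:Z - b%:Z)%Z then mono Q a b i j else 0.
    apply: avg_prim_root => // t; exact: gauge_mono.
  rewrite dvdz_small//; case: ifP => [|_]; last exact: lspan0.
  rewrite subr_eq0 eqz_nat => /eqP <-; apply: lspan_gen.
  by exists a, i, (j + i); rewrite cyl_upow_mono addrK.
exists (T M y); first exact: hM.
apply: le_lt_trans yx; apply: cnorm_avg_sub => //.
- by move=> t z _; exact: starHom_contractive.
- by move=> t; exact: hx.
Qed.

(** * Unitaries implementing the dual action *)

Lemma sum_periodic_shift (F : int -> Q) (n : nat) k :
  (forall l, F (l + n%:Z) = F l) ->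
  \sum_(l < n) F (l%:Z + k) = \sum_(l < n) F l%:Z.
Proof.
move=> hF; have step k' : \sum_(l < n) F (l%:Z + (k' + 1)) = \sum_(l < n) F (l%:Z + k').
  case: n hF => [|n] hF; first by rewrite !big_ord0.
  rewrite big_ord_recr big_ord_recl /= addrC; congr (_ + _).
    by rewrite add0r -[RHS]hF; congr F; rewrite -addn1 PoszD; ring.
  by apply: eq_bigr => l _; congr F; rewrite /bump /= PoszD; ring.
have nat_case (a : nat) k' : \sum_(l < n) F (l%:Z + (k' + a%:Z)) = \sum_(l < n) F (l%:Z + k').
  by elim: a => [|a IH]; rewrite ?addr0// -addn1 PoszD addrA step.
case: k => a; first by rewrite -[a%:Z]add0r nat_case; under eq_bigr do rewrite addr0.
rewrite -(nat_case a.+1 (Negz a)) NegzE addNr.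
by under eq_bigr do rewrite addr0.
Qed.

(** The function x |-> w^x on Z_p, which makes sense when w is a p^n-th root of
    unity. Conjugation by it fixes the cylinder projections and maps U to w U. *)
Definition dual_unitary n (w : R[i]) : Q := \sum_(l < p ^ n) w ^+ l *: e n l%:Z.

Section DualUnitary.
Variables (n : nat) (w : R[i]).
Hypotheses (w1 : `|w| = 1) (wn : w ^+ (p ^ n) = 1).
Local Notation d := (dual_unitary n w).

Lemma star_dual_unitary : star d = dual_unitary n w^-1.
Proof.
rewrite star_sum; apply: eq_bigr => l _.
rewrite starZ star_shifted_proj rmorphXn /= conj_unit_modulus//.
Qed.

Lemma dual_unitary_mul (v1 v2 : R[i]) :
  dual_unitary n v1 * dual_unitary n v2 = dual_unitary n (v1 * v2).
Proof.
rewrite /dual_unitary mulr_suml; apply: eq_bigr => l _.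
rewrite mulr_sumr (bigD1 l)//= big1 ?addr0.
  rewrite -scalerAl -scalerAr scalerA exprMn_comm; last exact: mulrC.
  by rewrite (shifted_proj_mul (padic_rel_exp n h)) subrr dvdz0.
move=> l' ll'; rewrite -scalerAl -scalerAr.
rewrite (shifted_proj_mul (padic_rel_exp n h)) ifF ?scaler0//.
apply/negP; rewrite dvdz_small; first by rewrite subr_eq0 eqz_nat => /eqP/val_inj/eqP; rewrite (negbTE ll').
have := ltn_ord l; have := ltn_ord l'; lia.
Qed.

Lemma dual_unitary1 : dual_unitary n 1 = 1.
Proof.
rewrite -[RHS](padic_rel_sum (padic_rel_exp n h)); apply: eq_bigr => l _.
by rewrite expr1n scale1r.
Qed.

Lemma dual_unitaryK : star d * d = 1.
Proof.
by rewrite star_dual_unitary dual_unitary_mul mulVf ?unit_modulus// dual_unitary1.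
Qed.

Lemma dual_unitaryVK : d * star d = 1.
Proof.
by rewrite star_dual_unitary dual_unitary_mul mulfV ?unit_modulus// dual_unitary1.
Qed.

Lemma dual_unitary_cyl (m : nat) i : GRing.comm (e m i) d.
Proof. by apply: commr_sum => l _; apply/commrZ/cyl_comm/h. Qed.

Lemma dual_unitary_upow k : d * upow U k = w ^ k *: (upow U k * d).
Proof.
have w0 := unit_modulus w1.
pose F l := w ^ l *: e n l.
have dE : d = \sum_(l < p ^ n) F l%:Z by [].
have Fper l : F (l + (p ^ n)%:Z) = F l.
  rewrite /F expfzDr// (_ : w ^ (p ^ n)%:Z = 1) ?mulr1//.
  by rewrite /cyl (shifted_proj_periodic (padic_rel_exp n h)).
rewrite {1}dE -(sum_periodic_shift k Fper) mulr_suml mulr_sumr scaler_sumr.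
apply: eq_bigr => l _; rewrite /F -scalerAl expfzDr// mulrC -scalerA.
by rewrite -scalerAr (upow_shifted_proj (padic_rel_exp n h)).
Qed.

Lemma dual_unitary_conj (m : nat) i k :
  d * (e m i * upow U k) * star d = w ^ k *: (e m i * upow U k).
Proof.
rewrite mulrA -(dual_unitary_cyl m i) -(mulrA (e m i)) dual_unitary_upow.
by rewrite -scalerAr -scalerAl !mulrA -(mulrA _ d) dual_unitaryVK mulr1.
Qed.

End DualUnitary.

End FixedPoints.

(** * The relative commutant of the range of chi_k *)

Section Scalars.
Variables (R : realType) (A : cstarAlgType R).

Definition scalars : set A := [set x | exists l : R[i], x = l%:A].

Lemma normc_ge_parts (a b : R) :
  `|a| <= normc (Complex a b) /\ `|b| <= normc (Complex a b).
Proof.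
rewrite /normc -!sqrtr_sqr !ler_sqrt ?addr_ge0 ?sqr_ge0//.
by rewrite lerDl lerDr !sqr_ge0.
Qed.

Lemma cnorm_scalar (l : R[i]) : cnorm (l%:A : A) = normc l.
Proof. by rewrite cnormZ cnorm1 mulr1. Qed.

(** The real and imaginary parts of approximating scalars determine Dedekind cuts,
    whose suprema are the parts of the limit. *)
Lemma scalars_closed x : adh scalars x -> scalars x.
Proof.
move=> hx.
have part (f : R[i] -> R) : (forall a b, `|f a - f b| <= normc (a - b)) ->
    exists r, forall (l : R[i]) (eps : R), cnorm (l%:A - x) < eps -> `|f l - r| <= eps.
  move=> fL; pose X := [set t | exists (l : R[i]) (eps : R),
    cnorm (l%:A - x) < eps /\ t = f l - eps].
  have dist l eps l' eps' : cnorm (l%:A - x) < eps -> cnorm (l'%:A - x) < eps' ->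
      f l - f l' <= eps + eps'.
    move=> h1 h2; apply: le_trans (ler_norm _) _; apply: le_trans (fL _ _) _.
    rewrite -cnorm_scalar scalerBl; have := cnorm_dist l%:A x l'%:A.
    by rewrite (cnormBC x); lra.
  have [y [l0 yE] hl0] := hx 1 ltr01; rewrite yE in hl0.
  have sX : has_sup X.
    split; first by exists (f l0 - 1), l0, 1.
    exists (f l0 + 1) => _ [l [eps [hl ->]]].
    by have := dist _ _ _ _ hl hl0; lra.
  exists (sup X) => l eps hl; rewrite ler_norml; apply/andP; split.
    have : sup X <= f l + eps; last by lra.
    apply: ge_sup; first by case: sX.
    by move=> _ [l' [eps' [hl' ->]]]; have := dist _ _ _ _ hl' hl; lra.
  have : f l - eps <= sup X; last by lra.
  by apply: sup_upper_bound => //; exists l, eps.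
have [|r hr] := part (fun z => complex.Re z).
  by move=> [a b] [a' b'] /=; case: (normc_ge_parts (a - a') (b - b')).
have [|s hs] := part (fun z => complex.Im z).
  by move=> [a b] [a' b'] /=; case: (normc_ge_parts (a - a') (b - b')).
exists (Complex r s); apply/eqP; rewrite -subr_eq0; apply/eqP/cnorm_eq0.
apply/ler_addgt0Pl => eps eps0; rewrite addr0.
have e3 : 0 < eps / 3 by rewrite divr_gt0.
have [y [l yE] hl] := hx _ e3; rewrite yE in hl.
have := hr _ _ hl; have := hs _ _ hl; move: hl; case: l {yE} => a b /= hl h1 h2.
have := cnorm_dist x (Complex a b)%:A (Complex r s)%:A.
rewrite (cnormBC x (Complex a b)%:A) -scalerBl cnorm_scalar.
have := normc_complex_le (a - r) (b - s).
rewrite -[Complex (a - r) (b - s)]/(Complex a b - Complex r s).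
by move=> *; lra.
Qed.

End Scalars.

Section RelativeCommutant.
Variables (R : realType) (p : nat) (Q : padicRingAlg R p).
Implicit Types (a b n : nat) (i j k m : int) (x y c g : Q).

Local Notation U := (padic_U Q).
Local Notation S := (padic_S Q).
Local Notation h := (padic_relP Q).

Let u1 : star U * U = 1. Proof. by case: h. Qed.
Let u2 : U * star U = 1. Proof. by case: h. Qed.
Local Notation e := (cyl U S).

Lemma conj_linear v (c : R[i]) x y :
  v * (c *: x + y) * star v = c *: (v * x * star v) + v * y * star v :> Q.
Proof. by rewrite mulrDr mulrDl -scalerAr -scalerAl. Qed.

Lemma commuting_conj v x : v * star v = 1 -> GRing.comm x v -> v * x * star v = x :> Q.
Proof. by move=> v1 xv; rewrite -xv -mulrA v1 mulr1. Qed.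

Definition cyls : set Q := [set x | exists n i, x = e n i].

Lemma powp_gt0 n : (0 < p ^ n)%N.
Proof. by rewrite expn_gt0 (rel_gt0 h). Qed.

(** Averaging over the dual action of all p^M-th roots of unity keeps only the
    Fourier coefficient of order 0 of elements of degree less than p^M. *)
Definition dual_avg (M : nat) : Q -> Q := avg (p ^ M)
  (fun t x => dual_unitary Q M (prim_root R (p ^ M) ^+ t) * x *
              star (dual_unitary Q M (prim_root R (p ^ M) ^+ t))).

(** Translations by multiples of k act transitively on the cosets of p^M Z_p when k
    is coprime with p, so this average sends every cylinder projection to its
    measure. *)
Definition trans_avg k (M : nat) : Q -> Q := avg (p ^ M)
  (fun t x => upow U (k * t%:Z) * x * star (upow U (k * t%:Z))).

Lemma prim_root_pow (M t : nat) : (prim_root R (p ^ M) ^+ t) ^+ (p ^ M) = 1.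
Proof. by rewrite exprAC prim_rootX ?powp_gt0// expr1n. Qed.

Lemma dual_avg_linear M (c : R[i]) x y :
  dual_avg M (c *: x + y) = c *: dual_avg M x + dual_avg M y.
Proof. by apply: avg_linear => *; exact: conj_linear. Qed.

Lemma trans_avg_linear k M (c : R[i]) x y :
  trans_avg k M (c *: x + y) = c *: trans_avg k M x + trans_avg k M y.
Proof. by apply: avg_linear => *; exact: conj_linear. Qed.

Lemma dual_avg_sub M x c : (forall n i, GRing.comm c (e n i)) ->
  cnorm (dual_avg M x - c) <= cnorm (x - c).
Proof.
move=> hc; apply: cnorm_avg_sub; first exact: powp_gt0.
- by move=> *; exact: conj_linear.
- by move=> t y _; apply/cnorm_conj/dual_unitaryK/norm_prim_rootX.
- move=> t; apply: commuting_conj; first exact/dual_unitaryVK/norm_prim_rootX.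
  by apply: commr_sum => l _; apply: commrZ.
Qed.

Lemma trans_avg_sub k M x c : GRing.comm c (upow U k) ->
  cnorm (trans_avg k M x - c) <= cnorm (x - c).
Proof.
move=> hc; apply: cnorm_avg_sub; first exact: powp_gt0.
- by move=> *; exact: conj_linear.
- by move=> t y _; apply/cnorm_conj; rewrite upowVK.
- move=> t; apply: commuting_conj; first by rewrite upowK.
  by rewrite upowMn//; exact: commrX.
Qed.

Lemma dual_avg_gen M n i m : (`|m| < p ^ M)%N ->
  dual_avg M (e n i * upow U m) = if m == 0 then e n i else 0.
Proof.
move=> mM; rewrite /dual_avg (@avg_prim_root _ _ _ _ _ m) ?powp_gt0//.
  by rewrite dvdz_small//; case: eqP => // ->; rewrite mulr1.
by move=> t; rewrite dual_unitary_conj ?norm_prim_rootX ?prim_root_pow.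
Qed.

Lemma trans_avg_cyl k n M i : coprimez k p -> (n <= M)%N ->
  trans_avg k M (e n i) = ((p ^ n)%:R^-1)%:A.
Proof.
move=> kp nM; rewrite /trans_avg /avg.
have kpn := coprimez_exp n kp.
transitivity ((p ^ M)%:R^-1 *: \sum_(t < p ^ M) e n (i + k * t%:Z)).
  congr (_ *: _); apply: eq_bigr => t _.
  by rewrite (upow_shifted_proj (padic_rel_exp n h)) -mulrA upowK// mulr1.
rewrite -(big_mkord xpredT (fun t => e n (i + k * t%:Z))).
rewrite -(subnK nM) expnD big_nat_mul big_mkord.
transitivity ((p ^ (M - n) * p ^ n)%:R^-1 *: \sum_(b < p ^ (M - n)) (1 : Q)).
  congr (_ *: _); apply: eq_bigr => b _.
  rewrite -{1}[(b * p ^ n)%N]add0n big_addn mulSn addnK big_mkord.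
  rewrite -[RHS](sum_shifted_proj (padic_rel_exp n h) i kpn).
  apply: eq_bigr => t _; rewrite PoszD PoszM mulrDr addrA mulrA.
  exact: (shifted_proj_periodicM (padic_rel_exp n h)).
rewrite sumr_const card_ord -(scaler_nat (p ^ (M - n)) (1 : Q)) scalerA natrM invfM.
by rewrite -mulrA mulrCA mulVf ?mulr1// pnatr_eq0 -lt0n powp_gt0.
Qed.

(** Averages over conjugations by elements of the range of chi_k do not move c, and
    the two averages turn an approximation of c in the core into a scalar. *)
Lemma relative_commutant_scalar k c : coprimez k p -> (1 < p)%N ->
  gauge_fixed Q c -> (forall n i, GRing.comm c (e n i)) ->
  GRing.comm c (upow U k) -> scalars c.
Proof.
move=> kp p1 /core_dense hc ce cu; apply: scalars_closed => eps /hc[b sb bc].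
have [M1 h1] : exists M0, forall M, (M0 <= M)%N -> lspan cyls (dual_avg M b).
  apply: span_eventually sb; first exact: dual_avg_linear.
  move=> _ [n [i [m ->]]]; exists `|m|%N => M hM; rewrite dual_avg_gen.
    case: ifP => _; last exact: lspan0.
    by apply: lspan_gen; exists n, i.
  by apply: leq_ltn_trans hM _; exact: ltn_expl.
have [M2 h2] : exists M0, forall M, (M0 <= M)%N ->
    lspan [set 1] (trans_avg k M (dual_avg M1 b)).
  apply: span_eventually (h1 _ (leqnn _)); first exact: trans_avg_linear.
  move=> _ [n [i ->]]; exists n => M nM; rewrite trans_avg_cyl//.
  by apply/lspanZ/lspan_gen.
exists (trans_avg k M2 (dual_avg M1 b)).
  elim: (h2 _ (leqnn _)) => [|a g x -> _ [l ->]]; first by exists 0; rewrite scale0r.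
  by exists (a + l); rewrite scalerDl.
apply: le_lt_trans bc; apply: le_trans (trans_avg_sub _ _ cu) _.
exact: dual_avg_sub.
Qed.

End RelativeCommutant.

(** * The dual automorphisms as limits of inner ones *)

Section DualAction.
Variables (R : realType) (p : nat) (Q : padicRingAlg R p).
Hypothesis p2 : (2 <= p)%N.
Implicit Types (a b n : nat) (i j k m : int) (x y c g : Q).

Local Notation U := (padic_U Q).
Local Notation S := (padic_S Q).
Local Notation h := (padic_relP Q).
Local Notation e := (cyl U S).
Local Notation B := (gauge_fixed Q).

Let u1 : star U * U = 1. Proof. by case: h. Qed.
Let u2 : U * star U = 1. Proof. by case: h. Qed.
Let D k m := upow_add u1 u2 k m.
Let N k := upowN U k.

Section Limit.
Variables (w : nat -> R[i]) (z : R[i]).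
Hypotheses (w1 : forall n, `|w n| = 1) (wp : forall n, w n ^+ (p ^ n) = 1).
Hypotheses (z1 : `|z| = 1) (wz : null (fun n => normc (w n - z))).

Local Notation d n := (dual_unitary Q n (w n)).
Local Notation Ad x := (fun n => d n * x * star (d n)).

Lemma Ad_cvg_gen n i m :
  cto (Ad (e n i * upow U m)) (z ^ m *: (e n i * upow U m)).
Proof.
have := nullZ (cnorm_ge0 (e n i * upow U m)) (expz_cvg m w1 z1 wz).
apply: null_le => l /=.
by rewrite dual_unitary_conj// -scalerBl cnormZ mulrC.
Qed.

(** Convergence on the core extends to its closure because the conjugations are
    uniformly contractive. *)
Lemma Ad_cvg x : B x -> exists y, cto (Ad x) y.
Proof.
move=> /core_dense hx; apply: cauchy_cto => eps eps0.
have e4 : 0 < eps / 4 by rewrite divr_gt0.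
have [b sb bx] := hx _ e4.
have [y hy] : exists y, cto (Ad b) y.
  elim: sb => [|a _ g' [n [i [m ->]]] _ [y hy]].
    exists 0; have := cto_cst (0 : Q); congr (cto _ _).
    by apply/funext => n; rewrite mulr0 mul0r.
  exists (a *: (z ^ m *: (e n i * upow U m)) + y).
  have := ctoD (ctoZ a (Ad_cvg_gen n i m)) hy; congr (cto _ _).
  by apply/funext => l; rewrite conj_linear.
have [M hM] := hy _ e4; exists M => n Mn.
have cl l : cnorm (d l * x * star (d l) - d l * b * star (d l)) < eps / 4.
  rewrite -mulrBl -mulrBr; apply: le_lt_trans bx; rewrite (cnormBC b).
  exact/cnorm_conj/dual_unitaryK.
pose X l := d l * x * star (d l); pose Y l := d l * b * star (d l).
have := cnorm_dist (X n) (Y n) (X M); have := cnorm_dist (Y n) (Y M) (X M).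
have := cnorm_dist (Y n) y (Y M); have := cl n; have := cl M.
have := hM _ Mn; have := hM _ (leqnn M).
rewrite -!/(X _) -!/(Y _) (cnormBC y (Y M)) (cnormBC (Y M) (X M)).
by move=> *; lra.
Qed.

End Limit.

Variable K : nat.
Hypothesis K0 : (0 < K)%N.

Let z (t : nat) : R[i] := prim_root R K ^+ t.

Let root_seq (t : nat) : nat -> R[i] :=
  projT1 (cid (@prim_root_approx R p K t p2 K0)).

Let root_seqP t : [/\ forall n, `|root_seq t n| = 1,
    forall n, root_seq t n ^+ (p ^ n) = 1
  & null (fun n => normc (root_seq t n - z t))].
Proof. by rewrite /root_seq; case: cid. Qed.

Let d t n : Q := dual_unitary Q n (root_seq t n).

(** With z the t-th power of a primitive K-th root of unity, the automorphism
    U |-> z U of the crossed product. It need not be inner, nor extend to Q_p,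
    but it is the pointwise limit of conjugations by the unitaries
    [dual_unitary], z being a limit of p-power roots of unity. *)
Definition dual t x : Q := xget 0 [set y | cto (fun n => d t n * x * star (d t n)) y].

Lemma dualP t x : B x -> cto (fun n => d t n * x * star (d t n)) (dual t x).
Proof.
move=> Bx; have [w1 wp wz] := root_seqP t.
exact: (xgetPex 0 (Ad_cvg w1 wp (norm_prim_rootX R K t) wz Bx)).
Qed.

Lemma dual_unique t x y : B x -> cto (fun n => d t n * x * star (d t n)) y -> dual t x = y.
Proof. by move=> /(dualP t) h1 h2; exact: cto_unique h1 h2. Qed.

Lemma dual_gen t n i m :
  dual t (e n i * upow U m) = z t ^ m *: (e n i * upow U m).
Proof.
apply: dual_unique; first exact: core_gen_fixed.
have [w1 wp wz] := root_seqP t.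
exact: (Ad_cvg_gen w1 wp (norm_prim_rootX R K t) wz).
Qed.

Let dK t n : star (d t n) * d t n = 1.
Proof. by have [w1 _ _] := root_seqP t; exact: dual_unitaryK. Qed.

Lemma dual_linear t (c : R[i]) x y : B x -> B y ->
  dual t (c *: x + y) = c *: dual t x + dual t y.
Proof.
move=> Bx By; apply: dual_unique; first exact: (sub_cstarP (gauge_fixed_sub Q)).
have := ctoD (ctoZ c (dualP t Bx)) (dualP t By); congr (cto _ _).
by apply/funext => n; rewrite conj_linear.
Qed.

Lemma dual_mul t x y : B x -> B y -> dual t (x * y) = dual t x * dual t y.
Proof.
move=> Bx By; apply: dual_unique; first exact: (sub_cstarM (gauge_fixed_sub Q)).
have := ctoM (dualP t Bx) (dualP t By); congr (cto _ _).
by apply/funext => n; rewrite -!mulrA (mulrA (star _)) dK mul1r.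
Qed.

Lemma dual_star t x : B x -> dual t (star x) = star (dual t x).
Proof.
move=> Bx; apply: dual_unique; first exact: (sub_cstar_star (gauge_fixed_sub Q)).
have := cto_star (dualP t Bx); congr (cto _ _).
by apply/funext => n; rewrite !starM starK mulrA.
Qed.

Lemma cnorm_dual t x : B x -> cnorm (dual t x) <= cnorm x.
Proof. by move=> Bx; apply: cto_norm_le (dualP t Bx) => n; exact: cnorm_conj. Qed.

Lemma dual_upow t m : dual t (upow U m) = z t ^ m *: upow U m.
Proof.
have -> : upow U m = e 0 0 * upow U m.
  by rewrite /cyl /shifted_proj /= star1 !mulr1 mul1r.
exact: dual_gen.
Qed.

Lemma dual_fixed_adh t (X : set Q) x :
  (forall y, X y -> B y /\ dual t y = y) -> B x -> adh X x -> dual t x = x.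
Proof.
move=> hX Bx /adhP[y hy yx]; apply: (@cto_unique _ _ y) => //.
apply: null_le (yx : null _) => n /=.
have [By {1}<-] := hX _ (hy n).
rewrite (_ : dual t (y n) - dual t x = - dual t (-1 *: y n + x)).
  apply: le_trans (_ : cnorm (- (-1 *: y n + x)) <= _).
    rewrite !cnormN; apply: cnorm_dual; exact: (sub_cstarP (gauge_fixed_sub Q)).
  by rewrite scaleN1r opprD opprK.
by rewrite dual_linear// scaleN1r opprD opprK.
Qed.

Lemma dual0 x : B x -> dual 0 x = x.
Proof.
move=> Bx; apply: (@dual_fixed_adh _ (lspan (core_gens Q))) => //; last exact: core_dense.
move=> y; elim=> [|c _ y' [n [i [m ->]]] _ [By' ey']].
  have B0 : B 0 by move=> zz z1; rewrite raddf0.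
  split=> //; have := dual_linear 0 (-1) B0 B0.
  by rewrite scaler0 addr0 scaleN1r addNr.
have Bg := @core_gen_fixed _ _ Q n i m.
split; first exact: (sub_cstarP (gauge_fixed_sub Q)).
by rewrite dual_linear// dual_gen ey' /z expr0 exp1rz scale1r.
Qed.

(** * The conditional expectation onto the range of chi_k *)

(** The average over the dual automorphisms of order dividing K keeps the Fourier
    coefficients whose order is a multiple of K. *)
Definition expectation x : Q := avg K dual x.
Local Notation E0 := expectation.

Lemma expectation_linear (c : R[i]) x y : B x -> B y ->
  E0 (c *: x + y) = c *: E0 x + E0 y.
Proof.
move=> Bx By; rewrite /E0 /avg scalerA mulrC -scalerA -scalerDr; congr (_ *: _).
rewrite scaler_sumr -big_split /=; apply: eq_bigr => t _; exact: dual_linear.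
Qed.

Lemma cnorm_expectation x : B x -> cnorm (E0 x) <= cnorm x.
Proof. by move=> Bx; apply: cnorm_avg => // t _; exact: cnorm_dual. Qed.

Lemma expectation_gen n i m :
  E0 (e n i * upow U m) = if (K%:Z %| m)%Z then e n i * upow U m else 0.
Proof. by apply: avg_prim_root => // t; exact: dual_gen. Qed.

Lemma expectation_upow m :
  E0 (upow U m) = if (K%:Z %| m)%Z then upow U m else 0.
Proof. by apply: avg_prim_root => // t; exact: dual_upow. Qed.

Lemma expectation_fixed x : (forall t, dual t x = x) -> E0 x = x.
Proof. exact: avg_fixed. Qed.

Lemma expectation_bimodule (a x b : Q) : B a -> B x -> B b ->
  (forall t, dual t a = a) -> (forall t, dual t b = b) ->
  E0 (a * x * b) = a * E0 x * b.
Proof.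
move=> Ba Bx Bb ha hb; have hM := sub_cstarM (gauge_fixed_sub Q).
rewrite /E0 /avg -scalerAr -scalerAl; congr (_ *: _).
rewrite mulr_sumr mulr_suml; apply: eq_bigr => t _.
by rewrite !dual_mul ?ha ?hb//; apply: hM.
Qed.

Lemma expectation_star_mul x : B x -> E0 (star x * x) =
  (K%:R^-1)%:C *: \sum_(t < K) star (dual t x) * dual t x.
Proof.
move=> Bx; rewrite /E0 /avg fmorphV rmorph_nat; congr (_ *: _).
apply: eq_bigr => t _; rewrite dual_mul ?dual_star//.
exact: (sub_cstar_star (gauge_fixed_sub Q)).
Qed.

Lemma expectation_pos x : B x -> pos (E0 (star x * x)).
Proof.
move=> Bx; rewrite expectation_star_mul//; apply: posZ; first by rewrite invr_ge0.
by apply: pos_sum => t; exact: pos_star_mul.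
Qed.

(** One of the automorphisms averaged is the identity. *)
Lemma expectation_faithful : faithful B E0.
Proof.
move=> x Bx; rewrite expectation_star_mul// => /eqP.
rewrite scaler_eq0 => /orP[|/eqP /pos_sum_eq0 hs].
  by rewrite eq_complex /= invr_eq0 pnatr_eq0 -leqn0 leqNgt K0.
have := hs (fun t => pos_star_mul _) (Ordinal K0); rewrite /= dual0// => e0.
by apply: cnorm0_eq0; apply/eqP; rewrite -sqrf_eq0 -cnorm_cstar e0 cnorm0.
Qed.

(** The j-th summand is the part of x of degree j modulo K, that is
    U^j E(U^-j x). *)
Lemma fourier_inversion x : B x ->
  \sum_(j < K) (K%:R^-1 : R[i]) *: \sum_(t < K) z t ^ (- j%:Z) *: dual t x = x.
Proof.
move=> Bx; rewrite -scaler_sumr exchange_big /=.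
under eq_bigr do rewrite -scaler_suml.
rewrite (bigD1 (Ordinal K0))//= [X in _ + X]big1 => [|t t0].
  rewrite addr0 dual0//; under eq_bigr do rewrite /z expr0 exp1rz.
  by rewrite sumr_const card_ord scalerA mulVf ?scale1r// pnatr_eq0 -lt0n.
have -> : \sum_(j < K) z t ^ (- j%:Z) = 0; last by rewrite scale0r.
transitivity (\sum_(j < K) (prim_root R K ^+ j) ^ (- t%:Z)).
  apply: eq_bigr => j _; rewrite /z -[_ ^+ t]/(_ ^ t%:Z) -[_ ^+ j]/(_ ^ j%:Z).
  by rewrite !exprz_exp mulrN mulrN mulrC.
rewrite sum_prim_root// dvdz_small; last by have := ltn_ord t; lia.
by rewrite oppr_eq0 eqz_nat ifF//; apply: contraNF t0 => /eqP t0; apply/eqP/val_inj.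
Qed.

Lemma expectation_star x : B x -> E0 (star x) = star (E0 x).
Proof.
move=> Bx; rewrite /E0 /avg starZ star_sum fmorphV rmorph_nat; congr (_ *: _).
by apply: eq_bigr => t _; rewrite dual_star.
Qed.

Lemma expectation_decomp x : B x ->
  x = \sum_(j < K) upow U j%:Z * E0 (star (upow U j%:Z) * x).
Proof.
move=> Bx; rewrite -{1}(fourier_inversion Bx); apply: eq_bigr => j _.
rewrite -N /E0 /avg -scalerAr; congr (_ *: _).
rewrite mulr_sumr; apply: eq_bigr => t _.
rewrite dual_mul//; last exact: upow_fixed.
by rewrite dual_upow -scalerAl -scalerAr mulrA -D subrr mul1r.
Qed.

Lemma expectation_quasi_basis :
  quasi_basis B E0 (fun j : 'I_K => upow U j%:Z).
Proof.
have hs := sub_cstar_star (gauge_fixed_sub Q).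
split=> [j|x Bx]; first exact: upow_fixed.
split; first exact: expectation_decomp.
rewrite -{1}[x]starK {1}(expectation_decomp (hs _ Bx)) star_sum.
apply: eq_bigr => j _; rewrite starM; congr (_ * _).
rewrite -expectation_star; first by rewrite starM !starK.
by apply: (sub_cstarM (gauge_fixed_sub Q)); apply: hs => //; exact: upow_fixed.
Qed.

End DualAction.

(** * Uniqueness of the expectation and its index *)

Lemma coprime_absz_gt0 (p : nat) (k : int) :
  (2 <= p)%N -> coprimez k p -> (0 < `|k|)%N.
Proof.
move=> p2; rewrite absz_gt0; apply: contraTneq => ->.
by rewrite coprimezE /= /coprime gcd0n; case: p p2 => [|[|]].
Qed.

Section Index.
Variables (R : realType) (p : nat) (Q : padicRingAlg R p).
Hypothesis p2 : (2 <= p)%N.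
Variables (k : int) (kp : coprimez k p).
Implicit Types (n : nat) (i j m : int) (x y : Q).

Local Notation U := (padic_U Q).
Local Notation S := (padic_S Q).
Local Notation h := (padic_relP Q).
Local Notation e := (cyl U S).
Local Notation B := (gauge_fixed Q).
Local Notation A := (chi Q kp @` gauge_fixed Q).
Local Notation K := `|k|%N.

Let u1 : star U * U = 1. Proof. by case: h. Qed.
Let u2 : U * star U = 1. Proof. by case: h. Qed.
Let D k m := upow_add u1 u2 k m.
Let N k := upowN U k.

Let K0 : (0 < K)%N := coprime_absz_gt0 p2 kp.

Let dvdK m : (K%:Z %| m)%Z = (k %| m)%Z.
Proof. by rewrite !dvdzE abszE. Qed.

Local Notation dual := (dual p2 K0).
Local Notation E0 := (expectation p2 K0).

Lemma upow_upow m : upow (upow U k) m = upow U (k * m).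
Proof.
case: m => n; first by rewrite upowMn.
by rewrite NegzE mulrN !upowN upowMn.
Qed.

Lemma chi_upow m : chi Q kp (upow U m) = upow U (k * m).
Proof. by have [kU _] := chiP Q kp; rewrite starHom_upow kU upow_upow. Qed.

Lemma chi_cyl n i : chi Q kp (e n i) = e n (k * i).
Proof.
have [kU kS] := chiP Q kp.
rewrite /cyl /shifted_proj !rmorphM /= starhomP !chi_upow rmorphXn /= kS.
by rewrite mulrN.
Qed.

Lemma solve_mod n i : exists i', ((p ^ n)%:Z %| k * i' - i)%Z.
Proof.
have kpn := coprimez_exp n kp.
have [u [v e1]] := Bezoutz k (p ^ n)%N.
move: kpn; rewrite /coprimez -e1 => /eqP e2.
exists (u * i); apply/dvdzP; exists (- v * i).
have -> : k * (u * i) = (u * k) * i by ring.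
have -> : u * k = 1 - v * (p ^ n)%N by rewrite -e2 addrK.
ring.
Qed.

Lemma cyl_in_range n i : A (e n i).
Proof.
have [i' hi] := solve_mod n i; exists (e n i'); first exact: cyl_fixed.
rewrite chi_cyl; apply/esym.
exact: (shifted_proj_mod (padic_rel_exp n h) hi).
Qed.

Lemma upow_in_range m : (k %| m)%Z -> A (upow U m).
Proof.
move=> /dvdzP[q ->]; exists (upow U q); first exact: upow_fixed.
by rewrite chi_upow mulrC.
Qed.

Definition chi_fixed : starHom (sub_cstarType (gauge_fixed_sub Q)) Q :=
  starHom_comp (chi Q kp) (sub_incl (gauge_fixed_sub Q)).

Lemma rangeE : A = range chi_fixed.
Proof.
apply/seteqP; split => [_ [x Bx <-]|_ [x _ <-]].
  by exists (sub_elt (gauge_fixed_sub Q) Bx).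
by exists (val x) => //; exact: sub_valX.
Qed.

Lemma range_cstar : sub_cstar A.
Proof.
have hB := gauge_fixed_sub Q; split.
- by exists 1; [exact: (sub_cstar1 hB)|rewrite rmorph1].
- move=> c _ _ [x Bx <-] [y By <-]; exists (c *: x + y); last by rewrite linearP.
  exact: (sub_cstarP hB).
- move=> _ _ [x Bx <-] [y By <-]; exists (x * y); last by rewrite rmorphM.
  exact: (sub_cstarM hB).
- move=> _ [x Bx <-]; exists (star x); last by rewrite starhomP.
  exact: (sub_cstar_star hB).
move=> y l hy yl; rewrite rangeE; apply: range_closed => eps /yl[n /(_ n (leqnn n)) hn].
by exists (y n); rewrite -?rangeE.
Qed.

(** The range of chi_k on the gauge-invariant part is closed, so it is enough to
    look at the generators of the core. *)
Lemma span_core_range x (T : Q -> Q) : B x -> (forall y, B y -> cnorm (T y) <= cnorm y) ->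
  (forall (c : R[i]) y z, B y -> B z -> T (c *: y + z) = c *: T y + T z) ->
  (forall n i m, A (T (e n i * upow U m))) -> A (T x).
Proof.
move=> Bx Tc Tl Tg; have hB := gauge_fixed_sub Q; have hA := range_cstar.
have core y : lspan (core_gens Q) y -> B y /\ A (T y).
  elim=> [|c _ z [n [i [m ->]]] _ [Bz ATz]].
    have B0 : B 0 by move=> zz z1; rewrite raddf0.
    split=> //; have := Tl (-1) _ _ B0 B0; rewrite scaler0 addr0 scaleN1r addNr => ->.
    by exists 0 => //; rewrite raddf0.
  have Bg := @core_gen_fixed _ _ Q n i m.
  by split; [exact: (sub_cstarP hB)|rewrite Tl//; exact: (sub_cstarP hA)].
rewrite rangeE; apply: range_closed => eps eps0.
have [y /core[By Ay] yx] := core_dense Bx eps0.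
exists (T y); first by rewrite -rangeE.
apply: le_lt_trans yx.
have -> : T y - T x = - T (-1 *: y + x) by rewrite Tl// scaleN1r opprD opprK.
have -> : y - x = - (-1 *: y + x) by rewrite scaleN1r opprD opprK.
by rewrite !cnormN; apply: Tc; exact: (sub_cstarP hB).
Qed.

Lemma expectation_range x : B x -> A (E0 x).
Proof.
move=> Bx; apply: span_core_range => //.
- exact: cnorm_expectation.
- by move=> *; exact: expectation_linear.
move=> n i m; rewrite expectation_gen dvdK; case: ifP => [km|_].
  by apply: (sub_cstarM range_cstar); [exact: cyl_in_range|exact: upow_in_range].
by exists 0; [move=> z z1|]; rewrite raddf0.
Qed.

(** Generators of the core are mapped by chi_k to generators of the core. *)
Lemma range_fixed x : A x -> B x.
Proof.
move=> [y By <-]; have hB := gauge_fixed_sub Q.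
have [y' hy' y'y] := adhP (core_dense By).
apply: (@sub_cstar_lim _ _ _ hB (fun n => chi Q kp (y' n))) => [n|].
  elim: (hy' n) => [|c _ z [l [i [m ->]]] _ IH].
    by move=> zz z1; rewrite !raddf0.
  rewrite linearP; apply: (sub_cstarP hB) => //.
  by rewrite rmorphM /= chi_cyl chi_upow; exact: core_gen_fixed.
apply: null_le (y'y : null _) => n /=.
by rewrite -raddfB; exact: starHom_contractive.
Qed.

Lemma dual_range t x : A x -> dual t x = x.
Proof.
move=> Ax; have hB := gauge_fixed_sub Q.
apply: (@dual_fixed_adh _ _ _ _ _ _ _ (chi Q kp @` lspan (core_gens Q))).
- move=> _ [y sy <-]; elim: sy => [|c _ z [l [i [m ->]]] _ [Bz dz]].
    have B0 : B 0 by move=> zz z1; rewrite raddf0.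
    rewrite raddf0; split=> //; have := dual_linear p2 K0 t (-1) B0 B0.
    by rewrite scaler0 addr0 scaleN1r addNr.
  have Bg := @core_gen_fixed _ _ Q l (k * i) (k * m).
  rewrite linearP /= rmorphM /= chi_cyl chi_upow; split; first exact: (sub_cstarP hB).
  rewrite dual_linear// dz dual_gen; congr (_ *: _ + _).
  rewrite -[_ ^+ t]/(_ ^ t%:Z) exprz_exp mulrCA -exprz_exp.
  by rewrite (_ : prim_root R K ^ k = 1) ?exp1rz ?scale1r//; apply/eqP; rewrite prim_root_eq1// dvdK.
- exact: range_fixed.
move: Ax => [y By <-] eps /(core_dense By)[z sz zy].
exists (chi Q kp z); first by exists z.
by rewrite -raddfB; apply: le_lt_trans zy; exact: starHom_contractive.
Qed.

Lemma expectationP : conditional_expectation A B E0.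
Proof.
split.
- exact: expectation_range.
- by move=> *; exact: expectation_linear.
- by move=> a Aa; apply: expectation_fixed => t; exact: dual_range.
- move=> a x b Aa Bx Ab; apply: expectation_bimodule => //; try exact: range_fixed.
    by move=> t; exact: dual_range.
  by move=> t; exact: dual_range.
move=> x Bx; have hB := gauge_fixed_sub Q.
have : A (E0 (star x * x)).
  by apply: expectation_range; apply: (sub_cstarM hB) => //; exact: (sub_cstar_star hB).
rewrite rangeE => /range_pos_root/(_ (expectation_pos _ _ Bx))[y py ey].
exists (chi_fixed y); first by exists y.
by rewrite -ey -starhomP (pos_sa py) -rmorphM.
Qed.

Section Uniqueness.
Variable E : Q -> Q.
Hypothesis hE : conditional_expectation A B E.

(** E(U^j) U^-j commutes with every element of the range whose translate by U^j is
    in the range too, so it is a scalar l. If l were nonzero, U^j would be in the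
    range, which contradicts the value 0 of [expectation] at U^j. *)
Lemma expectation_upow_eq0 j : ~~ (k %| j)%Z -> E (upow U j) = 0.
Proof.
move=> kj; have BU m : B (upow U m) by exact: upow_fixed.
have hB := gauge_fixed_sub Q.
have A1 : A 1 := sub_cstar1 range_cstar.
have BE : B (E (upow U j)) by apply/range_fixed/(ce_range hE).
pose c := E (upow U j) * upow U (- j).
(* b is the translate of a by U^j *)
have comm a b : A a -> A b -> a * upow U j = upow U j * b -> GRing.comm c a.
  move=> Aa Ab ab; rewrite /GRing.comm /c mulrA.
  have -> : a * E (upow U j) = E (upow U j) * b.
    have := ce_bimodule hE Aa (BU j) A1; rewrite !mulr1 => <-.
    have := ce_bimodule hE A1 (BU j) Ab; rewrite !mul1r => <-.
    by rewrite ab.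
  rewrite -!mulrA; congr (_ * _).
  rewrite -[LHS]mulr1 -(upowK u1 u2 j) !mulrA -(mulrA _ a) ab.
  by rewrite mulrA -D addNr mul1r -N.
have [l cE] : scalars c.
  apply: (relative_commutant_scalar kp) => //.
  - by apply: (sub_cstarM hB).
  - move=> n i; apply: (comm _ (e n (i - j))); try exact: cyl_in_range.
    by rewrite (upow_shifted_proj (padic_rel_exp n h)) subrK.
  - apply: (comm _ (upow U k)); try exact/upow_in_range/dvdzz.
    by rewrite -!D addrC.
have EU : E (upow U j) = l *: upow U j.
  by rewrite -[LHS]mulr1 -(upowVK u1 u2 j) -N mulrA -/c cE -scalerAl mul1r.
have [l0|/eqP l0] := pselect (l = 0); first by rewrite EU l0 scale0r.
have : E0 (E (upow U j)) = E (upow U j).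
  by apply: expectation_fixed => t; apply/dual_range/(ce_range hE).
have B0 : B 0 by move=> zz z1; rewrite raddf0.
rewrite EU -[l *: _]addr0 expectation_linear// expectation_upow dvdK (negbTE kj).
have -> : E0 (0 : Q) = 0.
  have := cnorm_expectation p2 K0 B0; rewrite cnorm0 => le0.
  exact: cnorm_eq0 le0.
by rewrite scaler0 !addr0 => <-.
Qed.

(** Every x is a combination of the U^i with coefficients in the range, and
    [expectation_upow_eq0] says that E reads off these coefficients. *)
Lemma expectation_decomp_any x : B x ->
  x = \sum_(j < K) upow U j%:Z * E (star (upow U j%:Z) * x).
Proof.
move=> Bx; rewrite {1}(expectation_decomp p2 K0 Bx); apply: eq_bigr => j _.
congr (_ * _); pose y (i : 'I_K) := E0 (star (upow U i%:Z) * x).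
rewrite -/(y j).
have hB := gauge_fixed_sub Q.
have BU m : B (upow U m) by exact: upow_fixed.
have Ay (i : 'I_K) : A (y i).
  apply: expectation_range; apply: (sub_cstarM hB) => //; exact: (sub_cstar_star hB).
have B0 : B 0 by move=> zz z1; rewrite raddf0.
have E00 : E 0 = 0.
  have := ce_linear hE (-1) B0 B0; by rewrite scaler0 addr0 scaleN1r addNr.
have BF (i : 'I_K) : B (upow U (i%:Z - j%:Z) * y i).
  by apply: (sub_cstarM hB) => //; exact: range_fixed.
have Esum (s : seq 'I_K) : B (\sum_(i <- s) upow U (i%:Z - j%:Z) * y i) /\
    E (\sum_(i <- s) upow U (i%:Z - j%:Z) * y i) =
    \sum_(i <- s) E (upow U (i%:Z - j%:Z)) * y i.
  elim: s => [|i s [Bs Es]]; first by rewrite !big_nil.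
  rewrite !big_cons; split.
    by rewrite -[X in X + _]scale1r; exact: (sub_cstarP hB).
  rewrite -[X in E (X + _)]scale1r (ce_linear hE)// scale1r Es; congr (_ + _).
  have := ce_bimodule hE (sub_cstar1 range_cstar) (BU (i%:Z - j%:Z)) (Ay i).
  by rewrite !mul1r.
have -> : star (upow U j%:Z) * x = \sum_(i < K) upow U (i%:Z - j%:Z) * y i.
  rewrite {1}(expectation_decomp p2 K0 Bx) mulr_sumr; apply: eq_bigr => i _.
  by rewrite addrC D N mulrA.
rewrite (Esum _).2 (bigD1 j)//= [X in _ + X]big1 => [|i ij].
  have -> : E (upow U (j%:Z - j%:Z)) = 1.
    by rewrite subrr; exact: (ce_id hE (sub_cstar1 range_cstar)).
  by rewrite mul1r addr0.
rewrite expectation_upow_eq0 ?mul0r// -dvdK dvdz_small; last first.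
  have := ltn_ord i; have := ltn_ord j; lia.
by rewrite subr_eq0 eqz_nat; apply: contra ij => /eqP/val_inj ->.
Qed.

(** The usual proof that the index does not depend on the quasi-basis, comparing v
    with the powers of U. *)
Lemma index_value n (v : 'I_n -> Q) : quasi_basis B E v ->
  \sum_(i < n) v i * star (v i) = K%:R%:A.
Proof.
move=> [Bv hv]; have hB := gauge_fixed_sub Q.
under eq_bigr do rewrite {1}(expectation_decomp_any (Bv _)) mulr_suml.
rewrite exchange_big /=.
transitivity (\sum_(j < K) upow U j%:Z * star (upow U j%:Z)).
  apply: eq_bigr => j _; under eq_bigr do rewrite -mulrA.
  rewrite -mulr_sumr; congr (_ * _); apply/esym.
  have BU : B (star (upow U j%:Z)) by apply/(sub_cstar_star hB)/upow_fixed.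
  by have [_ {1}->] := hv _ BU.
under eq_bigr do rewrite upowK//.
by rewrite sumr_const card_ord scaler_nat.
Qed.

End Uniqueness.

End Index.

Theorem theorem4p2 (R : realType) (p : nat) (hp : (2 <= p)%N)
    (Q : padicRingAlg R p) (k : int) (hk : coprimez k p) :
  is_watatani_index (chi Q hk @` gauge_fixed Q) (gauge_fixed Q) (`|k|%:~R : R).
Proof.
pose K0 := coprime_absz_gt0 hp hk.
have kE : (`|k|%:~R : R)%:C = `|k|%N%:R by rewrite -abszE rmorph_nat.
exists [set `|k|%:~R]; split; last exact: inf1; last first.
  by split; [exists `|k|%:~R|exists `|k|%:~R => _ ->].
apply/seteqP; split => [b [E [hE _ [n [v [hv ->]]]]]|_ [r -> <-]].
  by exists `|k|%:~R => //; rewrite (index_value hp hE hv) kE.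
exists (expectation hp K0); split.
- exact: expectationP.
- exact: expectation_faithful.
exists `|k|%N, (fun j : 'I_`|k|%N => upow (padic_U Q) j%:Z).
have hb := expectation_quasi_basis Q hp K0; split => //.
by rewrite (index_value hp (expectationP Q hp hk) hb) kE.
Qed.
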